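(* Let $X=L^\infty(\mathcal P)$ and write $N^{1,\infty}(\mathcal P)=N^1L^\infty(\mathcal P)$ and $C_\infty=C_{L^\infty}$. Assume that $L^\infty$-almost no nonconstant rectifiable curve exists in $\mathcal P$, i.e. the family of all nonconstant rectifiable curves in $\mathcal P$ has zero $L^\infty$-modulus, and that there is a point $x_0\in\mathcal P$ with $\mu(\{x_0\})=0$. Then $N^{1,\infty}(\mathcal P)=L^\infty(\mathcal P)$ and: (a) $\chi_{\{x_0\}}\in N^{1,\infty}(\mathcal P)$ is weakly quasicontinuous but not quasicontinuous; (b) $C_\infty$ is not an outer capacity, not even for sets of zero capacity; (c) if there is a closed set $F\subset\mathcal P$ with empty interior and $\mu(F)>0$, then $\chi_F\in N^{1,\infty}(\mathcal P)$ is not weakly quasicontinuous. In particular, all of (a)–(c) hold when $\mathcal P$ is the von Koch snowflake curve (with the Euclidean metric) equipped with the $\frac{\log 4}{\log 3}$-dimensional Hausdorff measure.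
   Context: Standing assumptions: $\mathcal P=(\mathcal P,d,\mu)$ is a metric space with a positive complete Borel measure $\mu$ such that $0<\mu(B)<\infty$ for every ball $B$; $\mu$ is extended as an outer measure to all subsets of $\mathcal P$. A curve is a continuous map from a compact interval; rectifiable curves are parametrized by arc length. For a function lattice $X$ of everywhere-defined measurable functions with quasinorm $\|\cdot\|_X$, a family $\Gamma$ of curves has zero $X$-modulus if there is a Borel $\rho\in X$ with $\int_\gamma\rho\,ds=\infty$ for all $\gamma\in\Gamma$. A Borel $g:\mathcal P\to[0,\infty]$ is an upper gradient of $u:\mathcal P\to[-\infty,\infty]$ if $|u(\gamma(0))-u(\gamma(l_\gamma))|\le\int_\gamma g\,ds$ for every nonconstant rectifiable curve $\gamma:[0,l_\gamma]\to\mathcal P$ (with $|(\pm\infty)-(\pm\infty)|=\infty$). The Newtonian space is $N^1X(\mathcal P)=\{u\in X:\|u\|_{N^1X}:=\|u\|_X+\inf_g\|g\|_X<\infty\}$, infimum over upper gradients $g$ of $u$. The capacity is $C_X(E)=\inf\{\|u\|_{N^1X}:u\in N^1X,\ u\ge1 \text{ on } E\}$. A function $u:\mathcal P\to[-\infty,\infty]$ is weakly quasicontinuous if for every $\varepsilon>0$ there is $E\subset\mathcal P$ with $C_X(E)<\varepsilon$ such that $u|_{\mathcal P\setminus E}$ is (real-valued) continuous; it is quasicontinuous if $E$ can moreover be chosen open. $C_X$ is an outer capacity if $C_X(E)=\inf\{C_X(G):G\supset E \text{ open}\}$ for all $E$; it is an outer capacity for sets of zero capacity if whenever $C_X(E)=0$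 and $\varepsilon>0$ there is an open $G\supset E$ with $C_X(G)<\varepsilon$. *)

(* Defs.v *)
From mathcomp Require Import all_boot all_order all_algebra.
From mathcomp Require Import all_classical all_reals all_analysis.
Import Order.TTheory GRing.Theory Num.Theory.

Set Implicit Arguments.
Unset Strict Implicit.
Unset Printing Implicit Defensive.

Local Open Scope classical_set_scope.
Local Open Scope ring_scope.

Definition is_metric (R : realType) (T : Type) (d : T -> T -> R) : Prop :=
  [/\ (forall x y, 0 <= d x y),
      (forall x y, d x y = 0 <-> x = y),
      (forall x y, d x y = d y x) &
      (forall x y z, d x z <= d x y + d y z)].

Definition dball (R : realType) (T : Type) (d : T -> T -> R) (x : T) (r : R)
  : set T := [set y | d x y < r].

Definition dopen (R : realType) (T : Type) (d : T -> T -> R) (G : set T) : Prop :=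
  forall x, G x -> exists r : R, 0 < r /\ dball d x r `<=` G.

Definition dclosed (R : realType) (T : Type) (d : T -> T -> R) (F : set T) : Prop :=
  dopen d (~` F).

Definition empty_interior (R : realType) (T : Type) (d : T -> T -> R) (F : set T)
  : Prop := forall G, dopen d G -> G `<=` F -> G = set0.

Definition Borel (R : realType) (T : Type) (d : T -> T -> R) : set (set T) :=
  <<s [set G | dopen d G] >>.

(* measurability of an extended-real valued function w.r.t. a sigma-algebra
   (the sets {f < a}, a real, generate the Borel sets of \bar R) *)
Definition meas_fun (R : realType) (T : Type) (S : set (set T)) (f : T -> \bar R)
  : Prop := forall a : R, S [set x | (f x < a%:E)%E].

Definition borel_fun (R : realType) (T : Type) (d : T -> T -> R) (f : T -> \bar R)
  : Prop := meas_fun (Borel d) f.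

(* Metric measure space: mu is a positive complete measure on the      *)
(* sigma-algebra M containing the Borel sets, with 0 < mu(B) < oo on   *)
(* balls; mu is extended to all subsets as the outer measure outer.    *)

Definition outer (R : realType) (T : Type) (M : set (set T)) (mu : set T -> \bar R)
  (E : set T) : \bar R :=
  ereal_inf [set mu A | A in [set A | M A /\ E `<=` A]].

Definition mm_space (R : realType) (T : Type) (d : T -> T -> R)
  (M : set (set T)) (mu : set T -> \bar R) : Prop :=
  [/\ is_metric d,
      sigma_algebra setT M &
      Borel d `<=` M] /\
  [/\ mu set0 = 0%E,
      (forall A, M A -> (0 <= mu A)%E),
      (forall F : nat -> set T, (forall i, M (F i)) -> trivIset setT F ->
          mu (\bigcup_i F i) = (\sum_(i <oo) mu (F i))%E),
      (forall A B, M A -> mu A = 0%E -> B `<=` A -> M B) &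
      (forall x (r : R), 0 < r ->
          (0 < mu (dball d x r))%E /\ (mu (dball d x r) < +oo)%E)].

Definition curve_length (R : realType) (T : Type) (d : T -> T -> R)
  (gam : R -> T) (s t : R) : \bar R :=
  ereal_sup [set v | exists (n : nat) (p : nat -> R),
     [/\ p 0%N = s, p n = t, (forall i, (i < n)%N -> p i <= p i.+1) &
         v = (\sum_(i < n) d (gam (p i)) (gam (p i.+1)))%:E]].

(* gam : [0, l] -> T is a nonconstant rectifiable curve parametrized by
   arc length (values of gam outside [0, l] are irrelevant).  Every
   nonconstant rectifiable curve has such an arc-length parametrization
   and conversely. *)
Definition arc_curve (R : realType) (T : Type) (d : T -> T -> R)
  (gam : R -> T) (l : R) : Prop :=
  0 < l /\
  forall s t, 0 <= s -> s <= t -> t <= l -> curve_length d gam s t = (t - s)%:E.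

Definition line_int (R : realType) (T : Type) (rho : T -> \bar R)
  (gam : R -> T) (l : R) : \bar R :=
  (\int[@lebesgue_measure R]_(t in `[0%R, l]%classic) rho (gam t))%E.

Definition Linf_norm (R : realType) (T : Type) (M : set (set T)) (mu : set T -> \bar R)
  (u : T -> \bar R) : \bar R :=
  ereal_inf [set c%:E | c in
    [set c : R | 0 <= c /\ outer M mu [set x | (c%:E < `|u x|)%E] = 0%E]].

Definition in_Linf (R : realType) (T : Type) (M : set (set T)) (mu : set T -> \bar R)
  (u : T -> \bar R) : Prop :=
  meas_fun M u /\ (Linf_norm M mu u < +oo)%E.

Definition zero_Linf_modulus (R : realType) (T : Type) (d : T -> T -> R)
  (M : set (set T)) (mu : set T -> \bar R) (Gam : (R -> T) -> R -> Prop) : Prop :=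
  exists rho : T -> \bar R,
    [/\ borel_fun d rho, (forall x, (0 <= rho x)%E), in_Linf M mu rho &
        forall gam l, Gam gam l -> line_int rho gam l = +oo%E].

Definition ediff (R : realType) (a b : \bar R) : \bar R :=
  if (a \is a fin_num) && (b \is a fin_num) then `|a - b|%E else +oo%E.

Definition upper_gradient (R : realType) (T : Type) (d : T -> T -> R)
  (u g : T -> \bar R) : Prop :=
  [/\ borel_fun d g, (forall x, (0 <= g x)%E) &
      forall gam l, arc_curve d gam l ->
        (ediff (u (gam 0%R)) (u (gam l)) <= line_int g gam l)%E].

Definition N1_norm (R : realType) (T : Type) (d : T -> T -> R)
  (M : set (set T)) (mu : set T -> \bar R) (u : T -> \bar R) : \bar R :=
  (Linf_norm M mu u +
   ereal_inf [set Linf_norm M mu g | g in [set g | upper_gradient d u g]])%E.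

Definition in_N1inf (R : realType) (T : Type) (d : T -> T -> R)
  (M : set (set T)) (mu : set T -> \bar R) (u : T -> \bar R) : Prop :=
  in_Linf M mu u /\ (N1_norm d M mu u < +oo)%E.

Definition Cap (R : realType) (T : Type) (d : T -> T -> R)
  (M : set (set T)) (mu : set T -> \bar R) (E : set T) : \bar R :=
  ereal_inf [set N1_norm d M mu u | u in
     [set u | in_N1inf d M mu u /\ forall x, E x -> (1 <= u x)%E]].

Definition cont_off (R : realType) (T : Type) (d : T -> T -> R)
  (u : T -> \bar R) (E : set T) : Prop :=
  (forall x, ~ E x -> u x \is a fin_num) /\
  (forall x, ~ E x -> forall eps : R, 0 < eps -> exists delta : R, 0 < delta /\
     forall y, ~ E y -> d x y < delta -> `|fine (u y) - fine (u x)| < eps).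

Definition weakly_quasicont (R : realType) (T : Type) (d : T -> T -> R)
  (M : set (set T)) (mu : set T -> \bar R) (u : T -> \bar R) : Prop :=
  forall eps : R, 0 < eps ->
    exists E, (Cap d M mu E < eps%:E)%E /\ cont_off d u E.

Definition quasicont (R : realType) (T : Type) (d : T -> T -> R)
  (M : set (set T)) (mu : set T -> \bar R) (u : T -> \bar R) : Prop :=
  forall eps : R, 0 < eps ->
    exists E, dopen d E /\ (Cap d M mu E < eps%:E)%E /\ cont_off d u E.

Definition outer_capacity (R : realType) (T : Type) (d : T -> T -> R)
  (M : set (set T)) (mu : set T -> \bar R) : Prop :=
  forall E, Cap d M mu E =
    ereal_inf [set Cap d M mu G | G in [set G | dopen d G /\ E `<=` G]].

Definition outer_capacity_zero (R : realType) (T : Type) (d : T -> T -> R)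
  (M : set (set T)) (mu : set T -> \bar R) : Prop :=
  forall E, Cap d M mu E = 0%E -> forall eps : R, 0 < eps ->
    exists G, [/\ dopen d G, E `<=` G & (Cap d M mu G < eps%:E)%E].

Definition chi (R : realType) (T : Type) (A : set T) : T -> \bar R :=
  fun x => ((\1_A x : R)%:E)%E.
Arguments chi {R T} A.

Definition thm_conclusions (R : realType) (T : Type) (d : T -> T -> R)
  (M : set (set T)) (mu : set T -> \bar R) (x0 : T) : Prop :=
  [/\ (forall u, in_N1inf d M mu u <-> in_Linf M mu u),
      [/\ in_N1inf d M mu (chi [set x0]),
          weakly_quasicont d M mu (chi [set x0]) &
          ~ quasicont d M mu (chi [set x0])],
      ~ outer_capacity d M mu /\ ~ outer_capacity_zero d M mu &
      (forall F, dclosed d F -> empty_interior d F -> (0 < outer M mu F)%E ->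
         in_N1inf d M mu (chi F) /\ ~ weakly_quasicont d M mu (chi F))].

Definition eucl (R : realType) (p q : R * R) : R :=
  Num.sqrt ((p.1 - q.1) ^+ 2 + (p.2 - q.2) ^+ 2).

(* the four similarities (ratio 1/3) of the Koch curve from (0,0) to (1,0) *)
Definition koch_map (R : realType) (i : nat) (p : R * R) : R * R :=
  let x := p.1 in let y := p.2 in
  let s := Num.sqrt (3 : R) in
  match i with
  | 0%N => (x / 3, y / 3)
  | 1%N => (1 / 3 + (x / 2 - y * s / 2) / 3, (x * s / 2 + y / 2) / 3)
  | 2%N => (1 / 2 + (x / 2 + y * s / 2) / 3, s / 6 + (- (x * s / 2) + y / 2) / 3)
  | _ => (2 / 3 + x / 3, y / 3)
  end.

(* Koch curve = attractor of the IFS = closure of the orbit of (0,0)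
   (which is a fixed point of the first map) *)
Definition koch_curve (R : realType) : set (R * R) :=
  [set p | forall eps : R, 0 < eps -> exists w : seq nat,
      eucl p (foldr (@koch_map R) (0, 0) w) < eps].

(* image of the Koch curve under the orientation-preserving similarity
   z |-> a + b z (complex notation) mapping 0 to a and 1 to a + b *)
Definition sim_image (R : realType) (a b : R * R) (K : set (R * R)) : set (R * R) :=
  [set (a.1 + (b.1 * z.1 - b.2 * z.2), a.2 + (b.1 * z.2 + b.2 * z.1)) | z in K].
Arguments sim_image {R} a b K.

(* snowflake: Koch curves erected outward on the sides of the equilateral
   triangle with vertices (0,0), (1,0), (1/2, -sqrt3/2) *)
Definition snowflake (R : realType) : set (R * R) :=
  let s := Num.sqrt (3 : R) in
  @koch_curve R
  `|` sim_image (1, 0) (- (1 / 2), - (s / 2)) (@koch_curve R)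
  `|` sim_image (1 / 2, - (s / 2)) (- (1 / 2), s / 2) (@koch_curve R).

Definition snowT (R : realType) : Type := {p : R * R | @snowflake R p}.

Definition snow_d (R : realType) (x y : snowT R) : R := eucl (sval x) (sval y).

Definition diam (R : realType) (T : Type) (d : T -> T -> R) (U : set T) : \bar R :=
  ereal_sup [set (d x y)%:E | x in U & y in U].

Definition hausdorff (R : realType) (T : Type) (d : T -> T -> R) (s : R) (E : set T)
  : \bar R :=
  ereal_sup [set Hd | Hd in [set Hd | exists delta : R, 0 < delta /\ Hd =
    ereal_inf [set v | exists U : nat -> set T,
       [/\ E `<=` \bigcup_i U i, (forall i, (diam d (U i) <= delta%:E)%E) &
           v = (\sum_(i <oo) ((fine (diam d (U i))) `^ s)%:E)%E]]]].

Definition snow_dim (R : realType) : R := ln (4 : R) / ln (3 : R).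

Definition snow_mu (R : realType) : set (snowT R) -> \bar R :=
  hausdorff (@snow_d R) (snow_dim R).

Definition snow_M (R : realType) : set (set (snowT R)) :=
  [set A | forall E, @snow_mu R E = (@snow_mu R (E `&` A) + @snow_mu R (E `\` A))%E].

(* Main.v *)
(* If almost no curve is rectifiable, small multiples of the function witnessing this are
   upper gradients of every function, so the N^{1,oo} norm is the L^oo norm: sets of
   measure zero have capacity zero when they are Borel, while a set of positive outer
   measure, in particular a nonempty open set, has capacity at least 1.

   For the snowflake, let s = log 4 / log 3. Parametrizing the Koch curve by the base-4
   expansion t of the address of a point p, the relation p ~ t is bijective and satisfies
   |t - u| <= 32 |p - q|^s, because distinct level-one cells are either far apart or lie
   in two cones separated by an angle of 60 degrees. Balls then have positive measure by
   comparison with Lebesgue measure in the parameter, and a curve parametrized by arc length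
   has a parameter which is Hoelder of exponent s > 1, hence constant. *)
Require Import Defs.
From HB Require Import structures.
From mathcomp Require Import all_boot all_order all_algebra.
From mathcomp Require Import all_classical all_reals all_analysis.
From mathcomp Require Import measurable_realfun ring lra zify.
Import Order.TTheory GRing.Theory Num.Theory numFieldNormedType.Exports.

Set Implicit Arguments.
Unset Strict Implicit.
Unset Printing Implicit Defensive.

Local Open Scope classical_set_scope.
Local Open Scope ring_scope.

(** * Null sets, capacity and arc-length curves in a metric measure space *)

Section metric_measure_space.
Context {R : realType} {T : Type}.
Variables (d : T -> T -> R) (M : set (set T)) (mu : set T -> \bar R).

(** The exponent s enters only through s > 0 and 3^s = 4. Scaling the plane by 1/3 and the parameter
    by 1/4 therefore preserves an inequality |t - u| <= C |p - q|^s, so only points in different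
    cells have to be compared and C does not grow with the depth. The obstacle is a pair of points
    in consecutive cells, both close to the common joint, where no fixed gap is available: there
    each parameter is compared with that of the joint separately, by a one-point estimate near an
    end of the curve. A joint has two addresses, so p ~ t is kept as a relation rather than a
    function. It is cut off at depth n, where the remainders are only known to lie in a triangle and
    in [0, 1]; every estimate is proved by induction with an error c k^n, which is then sent to 0.
    On the measure side, additivity of a Hausdorff measure is directly visible only for sets at
    positive distance, so Borel sets are reached through Caratheodory's criterion. *)

Lemma outer_le (E F : set T) : E `<=` F -> (outer M mu E <= outer M mu F)%E.
Proof.
by move=> EF; apply: ereal_inf_le_tmp => _ [A [MA FA] <-]; exists A => //; split => //;
  exact: subset_trans FA.
Qed.

Lemma Linf_norm_ge0 (u : T -> \bar R) : (0 <= Linf_norm M mu u)%E.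
Proof. by apply: le_ereal_inf_tmp => _ [c [c0 _] <-]; rewrite lee_fin. Qed.

Lemma Linf_norm_le (u : T -> \bar R) (c : R) : 0 <= c ->
  outer M mu [set x | (c%:E < `|u x|)%E] = 0%E -> (Linf_norm M mu u <= c%:E)%E.
Proof. by move=> c0 uc; apply: ereal_inf_lbound; exists c. Qed.

Lemma Linf_norm_le_N1_norm (u : T -> \bar R) :
  (Linf_norm M mu u <= N1_norm d M mu u)%E.
Proof.
rewrite /N1_norm leeDl//; apply: le_ereal_inf_tmp => _ [g _ <-].
exact: Linf_norm_ge0.
Qed.

Lemma Cap_ge0 (E : set T) : (0 <= Cap d M mu E)%E.
Proof.
apply: le_ereal_inf_tmp => _ [u _ <-].
exact: le_trans (Linf_norm_ge0 u) (Linf_norm_le_N1_norm u).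
Qed.

Lemma meas_fun_chi (S : set (set T)) (A : set T) :
  sigma_algebra setT S -> S A -> meas_fun S (chi A : T -> \bar R).
Proof.
move=> [S0 SC SU] SA a.
have SA' : S (~` A) by rewrite -setTD; exact: SC.
have ST : S setT by rewrite -(setD0 setT); exact: SC.
case: (leP a 0) => a0; [|case: (leP a 1) => a1].
- rewrite (_ : [set _ | _] = set0)//; apply/seteqP; split=> // x /=.
  rewrite /chi lte_fin indicE => /lt_le_trans -/(_ _ a0).
  by case: (_ \in _); rewrite ?ltr10 ?ltxx.
- rewrite (_ : [set _ | _] = ~` A)//; apply/seteqP; split=> x /=.
    rewrite /chi lte_fin indicE => + Ax; rewrite mem_set//= => /lt_le_trans -/(_ _ a1).
    by rewrite ltxx.
  by move=> Ax; rewrite /chi lte_fin indicE memNset.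
- rewrite (_ : [set _ | _] = setT)//; apply/seteqP; split=> // x _ /=.
  by rewrite /chi lte_fin indicE; case: (_ \in _) => //=; exact: (lt_trans ltr01).
Qed.

Lemma Linf_norm_chi_le1 (A : set T) : mu set0 = 0%E -> M set0 ->
  (forall B, M B -> 0 <= mu B)%E -> (Linf_norm M mu (chi A) <= 1)%E.
Proof.
move=> mu0 M0 mu_ge0; apply: Linf_norm_le => //.
rewrite (_ : [set _ | _] = set0); last first.
  apply/seteqP; split=> // x /=; rewrite /chi indicE.
  by case: (_ \in _); rewrite /= ?normr1 ?normr0 lte_fin ?ltxx ?ltr10.
apply/eqP; rewrite eq_le; apply/andP; split.
  by rewrite -[leRHS]mu0; apply: ereal_inf_lbound; exists set0 => //; split.
by apply: le_ereal_inf_tmp => _ [B [MB _] <-]; exact: mu_ge0.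
Qed.

Hypothesis mm : mm_space d M mu.

Let met : is_metric d. Proof. by case: mm => -[]. Qed.
Let Msa : sigma_algebra setT M. Proof. by case: mm => -[]. Qed.
Let BM : Borel d `<=` M. Proof. by case: mm => -[]. Qed.
Let mu0 : mu set0 = 0%E. Proof. by case: mm => _ []. Qed.
Let mu_ge0 A : M A -> (0 <= mu A)%E. Proof. by case: mm => _ [_ + _ _ _]; apply. Qed.

Let dopen_M G : dopen d G -> M G.
Proof. by move=> oG; apply: BM; exact: sub_gen_smallest. Qed.

Let M_setC A : M A -> M (~` A).
Proof. by case: Msa => _ MC _ /MC; rewrite setTD. Qed.

Let M_setU A B : M A -> M B -> M (A `|` B).
Proof.
move=> MA MB; rewrite -bigcup2E; case: Msa => M0 _; apply.
by case=> [//|[//|n]].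
Qed.

(** Since [mu] is a bare set function with countable additivity, monotonicity comes from the
    sequence A, B \ A, empty, empty, ... *)
Lemma mm_space_le (A B : set T) : M A -> M B -> A `<=` B -> (mu A <= mu B)%E.
Proof.
move=> MA MB AB; have MD : M (B `\` A).
  by rewrite setDE -(setCK B) -setCU; apply/M_setC/M_setU => //; exact: M_setC.
have MF i : M (bigcup2 A (B `\` A) i).
  by case: i => [//|[//|n]]; case: Msa.
have triv : trivIset setT (bigcup2 A (B `\` A)).
  by move=> [|[|i]] [|[|j]] _ _ //= [x [/= Ax Bx]];
    first [by case: Ax | by case: Bx].
have := (let: conj _ (And5 _ _ ca _ _) := mm in ca) _ MF triv.
rewrite bigcup2E setDE setUIr setUCr setIT setUidr// => ->.
apply: le_trans (nneseries_lim_ge 1 _) => /=; last by move=> n _ _; exact: mu_ge0 (MF n).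
by rewrite big_nat1.
Qed.

Let outer_ge0 E : (0 <= outer M mu E)%E.
Proof. by apply: le_ereal_inf_tmp => _ [A [MA _] <-]; exact: mu_ge0. Qed.

Lemma dball_dopen x (r : R) : dopen d (dball d x r).
Proof.
move=> y; rewrite /dball /= => xy; exists (r - d x y); split; first by rewrite subr_gt0.
move=> z /=; rewrite ltrBrDl; apply: le_lt_trans.
by case: met => _ _ _; exact.
Qed.

Lemma dball_center x (r : R) : 0 < r -> dball d x r x.
Proof. by move=> r0; rewrite /dball /=; case: met => _ /(_ x x)[_ ->]. Qed.

Lemma dball_outer_gt0 x (r : R) (E : set T) : 0 < r -> dball d x r `<=` E ->
  (0 < outer M mu E)%E.
Proof.
move=> r0 bE; have [b0 _] := (let: conj _ (And5 _ _ _ _ mb) := mm in mb) x r r0.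
apply: (lt_le_trans b0); apply: le_ereal_inf_tmp => _ [A [MA EA] <-].
apply: mm_space_le => //; last exact: subset_trans EA.
exact/dopen_M/dball_dopen.
Qed.

Lemma set1_dclosed x : dclosed d [set x].
Proof.
move=> y /= yx; exists (d y x); split.
  rewrite lt_neqAle eq_sym; case: met => d0 dE _ _; rewrite d0 andbT.
  by apply/eqP => /dE.
by move=> z /= + zx; rewrite /dball /= zx ltxx.
Qed.

Lemma dclosed_M F : dclosed d F -> M F.
Proof. by move=> cF; rewrite -(setCK F); exact/M_setC/dopen_M. Qed.

Lemma in_Linf_chi (A : set T) : M A -> in_Linf M mu (chi A).
Proof.
move=> MA; split; first exact: meas_fun_chi.
apply: (@le_lt_trans _ _ 1%E); last exact: ltry.
by apply: Linf_norm_chi_le1 => //; case: Msa.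
Qed.

(** If u >= 1 on E, an essential bound c < 1 of u would place E inside the null set where |u| >
    c. *)
Lemma Cap_ge1 (E : set T) : (0 < outer M mu E)%E -> (1 <= Cap d M mu E)%E.
Proof.
move=> E0; apply: le_ereal_inf_tmp => _ [u [_ uE] <-].
apply: le_trans (Linf_norm_le_N1_norm u).
apply: le_ereal_inf_tmp => _ [c [c0 cu] <-]; rewrite lee_fin leNgt; apply/negP => c1.
move: E0; rewrite ltNge => /negP; apply; rewrite -cu; apply: outer_le => x Ex /=.
by apply: lt_le_trans (lee_abs _); apply: lt_le_trans (uE _ Ex); rewrite lte_fin.
Qed.

Lemma Cap_lt1_outer0 (E : set T) : (Cap d M mu E < 1)%E -> outer M mu E = 0%E.
Proof.
move=> E1; apply/eqP; rewrite eq_le outer_ge0 andbT leNgt; apply/negP => /Cap_ge1.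
by move=> /(lt_le_trans E1); rewrite ltxx.
Qed.

Lemma arc_curve_lipschitz (gam : R -> T) l s t : arc_curve d gam l ->
  0 <= s -> s <= t -> t <= l -> d (gam s) (gam t) <= t - s.
Proof.
move=> [_ len] s0 st tl; rewrite -lee_fin -(len s t)//; apply: ereal_sup_ubound.
exists 1%N, (fun i => if i is 0%N then s else t); split => //.
  by case.
by rewrite big_ord1.
Qed.

(** A curve parametrized by arc length is 1-Lipschitz, so preimages of open sets are relatively open
    in [0, l]; this passes to the generated sigma-algebra and makes line integrals linear in
    [rho]. *)
Lemma measurable_borel_fun_arc (rho : T -> \bar R) (gam : R -> T) (l : R) :
  borel_fun d rho -> arc_curve d gam l ->
  measurable_fun (`[0, l]%classic : set R) (rho \o gam).
Proof.
move=> brho ag.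
have sub : Borel d `<=` [set A | measurable ((`[0, l]%classic : set R) `&` gam @^-1` A)].
  apply: smallest_sub.
    split=> /=.
    - by rewrite preimage_set0 setI0; exact: measurable0.
    - move=> A mA; rewrite setTD preimage_setC -setDE -[X in measurable X]set0U.
      by rewrite -(setDv `[0, l]%classic) -setDIr; exact: measurableD.
    - move=> A mA; rewrite preimage_bigcup setI_bigcupr.
      exact: bigcupT_measurable.
  move=> G oG /=.
  (* An honest open subset of the line whose trace on [0, l] is the preimage of [G]: each time
     carries the radius of a ball of the space inside [G], and the Lipschitz bound keeps the curve
     in that ball. *)
  pose O := \bigcup_(p in [set p : R * R | [/\ 0 <= p.1, p.1 <= l, 0 < p.2 &
    dball d (gam p.1) p.2 `<=` G]]) ball p.1 p.2.
  rewrite (_ : _ `&` _ = `[0, l]%classic `&` O).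
    apply: measurableI; first exact: measurable_itv.
    by apply: open_measurable; apply: bigcup_open => p _; exact: ball_open.
  apply/seteqP; split=> t /=; rewrite in_itv /= => -[/andP[t0 tl] Gt];
    split; rewrite ?t0//.
    have [r [r0 rG]] := oG _ Gt.
    by exists (t, r) => //; exact: ballxx.
  have [[s r] /= [s0 sl r0 rG]] := Gt; rewrite /ball /= => str.
  apply: rG; rewrite /dball /=.
  have [_ _ dC _] := met.
  case: (leP s t) => st.
    apply: (le_lt_trans (arc_curve_lipschitz ag s0 st tl)).
    by move: str; rewrite distrC ger0_norm// subr_ge0.
  rewrite dC; apply: (le_lt_trans (arc_curve_lipschitz ag t0 (ltW st) sl)).
  by move: str; rewrite gtr0_norm// subr_gt0.
apply: (measurability _ (ErealGenInftyO.measurableE R)) => _ /= -[_ [r ->] <-].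
rewrite preimage_itvNyo; exact: sub (brho r).
Qed.

Lemma line_intZ (rho : T -> \bar R) (gam : R -> T) (l k : R) :
  borel_fun d rho -> (forall x, 0 <= rho x)%E -> arc_curve d gam l -> 0 <= k ->
  line_int (fun x => k%:E * rho x)%E gam l = (k%:E * line_int rho gam l)%E.
Proof.
move=> brho rho0 ag k0; apply: ge0_integralZl_EFin => //.
exact: measurable_borel_fun_arc.
Qed.


(** * Capacity and quasicontinuity when almost no curve is rectifiable *)

Section negligible_curves.
Hypothesis mod0 : zero_Linf_modulus d M mu (arc_curve d).

Lemma small_upper_gradient (eps : R) : 0 < eps ->
  exists g : T -> \bar R, (forall u, upper_gradient d u g) /\
    (Linf_norm M mu g <= eps%:E)%E.
Proof.
case: mod0 => rho [brho rho0 [_ rhooo] lrho] e0.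
have [_ [c [c0 rhoc] <-] _] := ereal_inf_lt rhooo.
have c1 : 0 < c + 1 by rewrite ltr_wpDl.
(* Here c is an essential bound of [rho]; adding 1 keeps the divisor positive when c = 0. *)
pose k := eps / (c + 1).
have k0 : 0 < k by rewrite divr_gt0.
exists (fun x => k%:E * rho x)%E; split=> [u|].
  split.
  - move=> a; rewrite (_ : [set _ | _] = [set x | (rho x < (k^-1 * a)%:E)%E]).
      exact: brho.
    by apply/funext => x /=; rewrite -lte_pdivlMl.
  - by move=> x; rewrite mule_ge0// lee_fin ltW.
  (* The line integral is k times infinity, which also dominates the value [+oo] that [ediff] takes
     at infinite values of u. *)
  - move=> gam l ag; rewrite line_intZ//; last exact: ltW.
    by rewrite lrho// gt0_muley ?lte_fin// leey.
apply: (@le_trans _ _ (k * c)%:E); last first.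
  rewrite lee_fin /k -mulrA ger_pMr// mulrC ler_pdivrMr// mul1r.
  by rewrite lerDl.
apply: Linf_norm_le; first by rewrite mulr_ge0// ltW.
rewrite -[RHS]rhoc; congr (outer M mu _); apply/funext => x /=.
by rewrite abseM gee0_abs ?lee_fin ?ltW// EFinM lte_pmul2l// lte_fin.
Qed.

Lemma N1_normE (u : T -> \bar R) : N1_norm d M mu u = Linf_norm M mu u.
Proof.
rewrite /N1_norm -[RHS]adde0; congr (_ + _)%E; apply/eqP; rewrite eq_le.
apply/andP; split; last by apply: le_ereal_inf_tmp => _ [g _ <-]; exact: Linf_norm_ge0.
apply/lee_addgt0Pr => e e0; rewrite add0e.
have [g [ug ge]] := small_upper_gradient e0.
by apply: le_trans ge; apply: ereal_inf_lbound; exists g => //; exact: ug.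
Qed.

Lemma in_N1inf_iff (u : T -> \bar R) : in_N1inf d M mu u <-> in_Linf M mu u.
Proof. by rewrite /in_N1inf N1_normE; split=> [[]//|Lu]; split=> //; case: Lu. Qed.

Variable x0 : T.
Hypothesis x0_null : outer M mu [set x0] = 0%E.

Lemma Cap_set1 : Cap d M mu [set x0] = 0%E.
Proof.
apply/eqP; rewrite eq_le Cap_ge0 andbT.
apply: (@le_trans _ _ (N1_norm d M mu (chi [set x0]))).
  apply: ereal_inf_lbound; exists (chi [set x0]) => //; split.
    exact/in_N1inf_iff/in_Linf_chi/dclosed_M/set1_dclosed.
  by move=> x /= ->; rewrite /chi indicE mem_set.
rewrite N1_normE; apply: Linf_norm_le => //.
rewrite -[RHS]x0_null; congr (outer M mu _); apply/seteqP; split=> x /=.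
  by rewrite /chi indicE; case: (boolP (_ \in _)); rewrite ?inE//= normr0 ltxx.
by move=> ->; rewrite /chi indicE mem_set//= normr1 lte_fin ltr01.
Qed.

Lemma dopen_Cap_ge1 (G : set T) x : dopen d G -> G x -> (1 <= Cap d M mu G)%E.
Proof.
by move=> oG /oG[r [r0 rG]]; apply: Cap_ge1; exact: dball_outer_gt0 rG.
Qed.

Lemma chi_set1_weakly_quasicont : weakly_quasicont d M mu (chi [set x0]).
Proof.
move=> eps eps0; exists [set x0]; rewrite Cap_set1 lte_fin; split=> //.
split=> // x xx0 e e0; exists 1; split=> // y yx0 _.
by rewrite /chi !indicE !memNset//= subrr normr0.
Qed.

(** A nonempty open set has capacity at least 1, so the open exceptional set for eps = 1 is empty.
    Continuity at [x0] would then make [x0] isolated, and a ball equal to {x0} has positive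
    measure. *)
Lemma chi_set1_not_quasicont : ~ quasicont d M mu (chi [set x0]).
Proof.
move=> /(_ 1 ltr01)[E [oE [E1 [_ cE]]]].
have E0 x : ~ E x.
  by move=> /(dopen_Cap_ge1 oE)/(lt_le_trans E1); rewrite ltxx.
have [delta [delta0 near]] := cE x0 (E0 x0) 1 ltr01.
have : (0 < outer M mu [set x0])%E.
  apply: (@dball_outer_gt0 x0 delta) => // y /= /(near y (E0 y)).
  rewrite /chi !indicE (mem_set (erefl : [set x0] x0))/=.
  case: (boolP (_ \in _)); rewrite ?inE//= => _.
  by rewrite sub0r normrN normr1 ltxx.
by rewrite x0_null ltxx.
Qed.

Lemma not_outer_capacity_zero : ~ outer_capacity_zero d M mu.
Proof.
move=> /(_ _ Cap_set1 1 ltr01)[G [oG x0G]].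
by rewrite ltNge (dopen_Cap_ge1 oG (x0G _ erefl)).
Qed.

Lemma not_outer_capacity : ~ outer_capacity d M mu.
Proof.
move=> /(_ [set x0]); rewrite Cap_set1 => H.
have : (ereal_inf [set Cap d M mu G | G in [set G | dopen d G /\ [set x0] `<=` G]] < 1)%E.
  by rewrite -H lte01.
move=> /ereal_inf_lt[_ [G [oG x0G] <-]].
by rewrite ltNge (dopen_Cap_ge1 oG (x0G _ erefl)).
Qed.

(** The exceptional set E for eps = 1 is null, so some x in F lies off E. Near x, continuity off E
    forces every point outside F to lie in E. Since F is closed with empty interior, these points
    form a nonempty open set, which cannot be null. *)
Lemma chi_not_weakly_quasicont (F : set T) : dclosed d F -> empty_interior d F ->
  (0 < outer M mu F)%E -> ~ weakly_quasicont d M mu (chi F).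
Proof.
move=> cF eF F0 /(_ 1 ltr01)[E [/Cap_lt1_outer0 E0 [_ cE]]].
have [x Fx Ex] : exists2 x, F x & ~ E x.
  apply: contrapT => /forall2NP H; move: F0; rewrite ltNge -E0 => /negP; apply.
  by apply: outer_le => x Fx; case: (H x) => // /contrapT.
have [delta [delta0 near]] := cE x Ex 1 ltr01.
have oG : dopen d (dball d x delta `\` F).
  move=> y [yx Fy]; have [r [r0 rb]] := dball_dopen yx.
  have [s [s0 sb]] := cF _ Fy.
  exists (Num.min r s); split; first by rewrite lt_min r0.
  by move=> z; rewrite /dball /= lt_min => /andP[zr zs]; split; [exact: rb|exact: sb].
have [y Gy] : exists y, (dball d x delta `\` F) y.
  apply: contrapT => /forallNP H.
  have bF : dball d x delta `<=` F by move=> y yx; apply: contrapT => Fy; exact: (H y).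
  have := eF _ (@dball_dopen _ _) bF.
  by move=> /seteqP[/(_ x) + _]; apply; exact: dball_center.
have [r [r0 rG]] := oG _ Gy.
have : (0 < outer M mu E)%E.
  apply: (dball_outer_gt0 r0) => z /rG[zx Fz]; apply: contrapT => Ez.
  have := near z Ez zx; rewrite /chi !indicE memNset// (mem_set Fx)/=.
  by rewrite sub0r normrN normr1 ltxx.
by rewrite E0 ltxx.
Qed.

Lemma negligible_curves_conclusions : thm_conclusions d M mu x0.
Proof.
split; first exact: in_N1inf_iff.
- split; [|exact: chi_set1_weakly_quasicont|exact: chi_set1_not_quasicont].
  exact/in_N1inf_iff/in_Linf_chi/dclosed_M/set1_dclosed.
- by split; [exact: not_outer_capacity|exact: not_outer_capacity_zero].
- move=> F cF eF F0; split; last exact: chi_not_weakly_quasicont.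
  exact/in_N1inf_iff/in_Linf_chi/dclosed_M.
Qed.

End negligible_curves.
End metric_measure_space.

(** * Hausdorff measures *)

Section nneseries_extra.
Context {R : realType}.
Local Open Scope ereal_scope.

(** Merges countably many countable covers into one; the enumeration is returned because the
    covering sets are reindexed along with the sum. *)
Lemma nneseries_pairing (a : nat * nat -> \bar R) : (forall p, 0 <= a p) ->
  exists f : nat -> nat * nat, (forall p, exists n, f n = p) /\
    \sum_(n <oo) a (f n) = \sum_(i <oo) \sum_(j <oo) a (i, j).
Proof.
move=> a0; have /card_esym/ppcard_eqP[f] := card_nat2.
exists f; split=> [p|].
  by exists (f^-1%FUN p); rewrite invK ?inE.
rewrite !nneseries_esumT//; last by move=> n; exact: nneseries_ge0.
rewrite -(reindex_esum setT setT f); last exact: 'bij_f.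
under [RHS]eq_esum do rewrite nneseries_esumT//.
rewrite esum_esum// (_ : _ `*`` _ = setT); first by apply: eq_esum => -[].
by apply/seteqP; split=> [] [].
Qed.

Lemma nneseries_finite_le (a : nat -> \bar R) (N : nat) (c : R) :
  (forall n, 0 <= a n) -> (forall n, (n < N)%N -> a n <= c%:E) ->
  (forall n, (N <= n)%N -> a n = 0) -> \sum_(n <oo) a n <= (N%:R * c)%:E.
Proof.
move=> a0 aN a0'; rewrite (nneseries_split 0%N N)// add0n.
rewrite [X in _ + X]eseries0; last by move=> i /a0'.
rewrite adde0 big_mkord; apply: (@le_trans _ _ (\sum_(i < N) c%:E)).
  by apply: lee_sum => i _; exact: aN.
by rewrite sumEFin sumr_const card_ord mulr_natl.
Qed.

End nneseries_extra.

Section hausdorff_measure.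
Context {R : realType} {T : Type}.
Variables (d : T -> T -> R) (s : R).
Hypothesis s_neq0 : s != 0.
Local Open Scope ereal_scope.

(** [fine] sends an infinite diameter to 0, which is harmless in the covers below because their
    members have diameter at most [delta]. *)
Definition diam_powR (U : set T) : \bar R := ((fine (diam d U)) `^ s)%:E.

Definition hausdorff_content (delta : R) (E : set T) : \bar R :=
  ereal_inf [set v | exists U : nat -> set T,
    [/\ E `<=` \bigcup_i U i, (forall i, diam d (U i) <= delta%:E) &
        v = \sum_(i <oo) diam_powR (U i)]].

Lemma hausdorffE E : hausdorff d s E =
  ereal_sup [set v | exists delta : R, (0 < delta)%R /\ v = hausdorff_content delta E].
Proof.
rewrite /hausdorff; congr ereal_sup.
by apply/seteqP; split=> [_ [v vE <-]//|v vE]; exists v.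
Qed.

Lemma diam_powR_ge0 U : 0 <= diam_powR U.
Proof. by rewrite lee_fin powR_ge0. Qed.

Lemma diam_set0 : diam d set0 = -oo.
Proof.
rewrite /diam (_ : image2 _ _ _ = set0) ?ereal_sup0//.
by apply/seteqP; split=> // x [y].
Qed.

(** The diameter of the empty set is a supremum over nothing, [-oo], whose [fine] is 0, and 0^s = 0
    because s is nonzero. Padding a cover with empty sets is thus free. *)
Lemma diam_powR_set0 : diam_powR set0 = 0.
Proof. by rewrite /diam_powR diam_set0/= powR0. Qed.

Lemma content_le_hausdorff delta E : (0 < delta)%R ->
  hausdorff_content delta E <= hausdorff d s E.
Proof. by move=> d0; rewrite hausdorffE; apply: ereal_sup_ubound; exists delta. Qed.

Lemma hausdorff_content_ge0 delta E : 0 <= hausdorff_content delta E.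
Proof.
apply: le_ereal_inf_tmp => _ [U [_ _ ->]].
by apply: nneseries_ge0 => *; exact: diam_powR_ge0.
Qed.

Lemma hausdorff_ge0 E : 0 <= hausdorff d s E.
Proof. exact: le_trans (hausdorff_content_ge0 1 E) (content_le_hausdorff E ltr01). Qed.

Lemma hausdorff_content_subset delta E F : E `<=` F ->
  hausdorff_content delta E <= hausdorff_content delta F.
Proof.
move=> EF; apply: ereal_inf_le_tmp => _ [U [FU dU ->]]; exists U; split=> //.
exact: subset_trans FU.
Qed.

Lemma hausdorff_subset : {homo hausdorff d s : E F / E `<=` F >-> E <= F}.
Proof.
move=> E F EF; rewrite hausdorffE; apply: ge_ereal_sup => _ [delta [d0 ->]].
exact: le_trans (hausdorff_content_subset delta EF) (content_le_hausdorff F d0).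
Qed.

Lemma hausdorff_content_sigma_subadditive delta :
  sigma_subadditive (hausdorff_content delta).
Proof.
move=> A; have [[i ioo]|] := pselect (exists i, hausdorff_content delta (A i) = +oo).
  rewrite (eseries_pinfty _ _ ioo) ?leey// => n _.
  by rewrite -ltNye (lt_le_trans _ (hausdorff_content_ge0 _ _)).
move=> /forallNP Aoo; apply/lee_addgt0Pr => e e0.
apply: le_trans (epsilon_trick xpredT (fun n => hausdorff_content_ge0 delta (A n)) (ltW e0)).
have cover n : exists U : nat -> set T, [/\ A n `<=` \bigcup_i U i,
    (forall i, diam d (U i) <= delta%:E) &
    \sum_(i <oo) diam_powR (U i) <=
      hausdorff_content delta (A n) + (e / (2 ^ n.+1)%:R)%:E].
  have en : (0 < e / (2 ^ n.+1)%:R)%R by rewrite divr_gt0// ltr0n expn_gt0.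
  have fin : hausdorff_content delta (A n) \is a fin_num.
    by rewrite ge0_fin_numE ?hausdorff_content_ge0// ltey; apply/eqP; exact: Aoo.
  have [_ [U [AU dU ->]] /ltW Ue] := lb_ereal_inf_adherent en fin.
  by exists U.
have [U UP] := choice cover.
have [f [fsurj fE]] := nneseries_pairing (fun p => diam_powR_ge0 (U p.1 p.2)).
apply: (@le_trans _ _ (\sum_(n <oo) diam_powR (U (f n).1 (f n).2))).
  apply: ereal_inf_lbound; exists (fun n => U (f n).1 (f n).2); split=> //.
    move=> x [i _ Aix]; have [AU _ _] := UP i; have [j _ Uijx] := AU _ Aix.
    by have [n fn] := fsurj (i, j); exists n => //; rewrite fn.
  by move=> n; have [_ + _] := UP (f n).1; apply.
rewrite fE; apply: lee_nneseries => [i _ _|i _].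
  by apply: nneseries_ge0 => *; exact: diam_powR_ge0.
by have [] := UP i.
Qed.

Lemma hausdorff_sigma_subadditive : sigma_subadditive (hausdorff d s).
Proof.
move=> A; rewrite hausdorffE; apply: ge_ereal_sup => _ [delta [d0 ->]].
apply: (le_trans (hausdorff_content_sigma_subadditive delta A)).
apply: lee_nneseries => [i _ _|i _]; first exact: hausdorff_content_ge0.
exact: content_le_hausdorff.
Qed.

Lemma hausdorff0 : hausdorff d s set0 = 0.
Proof.
apply/eqP; rewrite eq_le hausdorff_ge0 andbT hausdorffE.
apply: ge_ereal_sup => _ [delta [d0 ->]]; apply: ereal_inf_lbound.
exists (fun=> set0); split=> [//|i|]; first by rewrite diam_set0 leNye.
by rewrite eseries0// => i _ _; exact: diam_powR_set0.
Qed.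

HB.instance Definition _ := isOuterMeasure.Build R T (hausdorff d s)
  hausdorff0 hausdorff_ge0 hausdorff_subset hausdorff_sigma_subadditive.

Lemma hausdorff_set1 x : d x x = 0%R -> hausdorff d s [set x] = 0.
Proof.
move=> dxx; apply/eqP; rewrite eq_le hausdorff_ge0 andbT hausdorffE.
apply: ge_ereal_sup => _ [delta [d0 ->]].
have dx : diam d [set x] = 0.
  rewrite /diam (_ : image2 _ _ _ = [set 0]) ?ereal_sup1//.
  apply/seteqP; split=> [_ [y /= -> [z -> <-]]|_ ->] /=; first by rewrite dxx.
  by exists x => //; exists x => //; rewrite dxx.
apply: ereal_inf_lbound; exists (fun=> [set x]); split=> [y ->|i|].
- by exists 0%N.
- by rewrite dx lee_fin ltW.
- by rewrite eseries0// => i _ _; rewrite /diam_powR dx powR0.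
Qed.

(** Contents increase as the scale shrinks, so a lower bound may be tested at the single scale 1,
    where diameters are also not [+oo]. *)
Lemma le_hausdorff (c : \bar R) E :
  (forall U : nat -> set T, E `<=` \bigcup_i U i ->
    (forall i, diam d (U i) <= 1%:E) -> c <= \sum_(i <oo) diam_powR (U i)) ->
  c <= hausdorff d s E.
Proof.
move=> cE; apply: le_trans (content_le_hausdorff E ltr01).
by apply: le_ereal_inf_tmp => _ [U [EU dU ->]]; exact: cE.
Qed.

Definition separated (eta : R) (A B : set T) :=
  (0 < eta)%R /\ forall x y, A x -> B y -> (eta <= d x y)%R.

Lemma diam_ge (U : set T) x y : U x -> U y -> (d x y)%:E <= diam d U.
Proof. by move=> Ux Uy; apply: ereal_sup_ubound; exists x => //; exists y. Qed.

Lemma hausdorff_content_scale_le (delta eps : R) E : (delta <= eps)%R ->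
  hausdorff_content eps E <= hausdorff_content delta E.
Proof.
move=> de; apply: ereal_inf_le_tmp => _ [U [EU dU ->]]; exists U; split=> // i.
by apply: le_trans (dU i) _; rewrite lee_fin.
Qed.

(* A set of diameter less than eta meets at most one of A and B. *)
Lemma hausdorff_separated eta A B : separated eta A B ->
  hausdorff d s A + hausdorff d s B <= hausdorff d s (A `|` B).
Proof.
move=> [eta0 AB].
have content delta : (0 < delta)%R -> (delta < eta)%R ->
    hausdorff_content delta A + hausdorff_content delta B <= hausdorff d s (A `|` B).
  move=> d0 deta; apply: le_trans (content_le_hausdorff _ d0).
  apply: le_ereal_inf_tmp => _ [U [ABU dU ->]].
  pose UA i := if pselect (U i `&` A !=set0) then U i else set0.
  pose UB i := if pselect (U i `&` A !=set0) then set0 else U i.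
  have dset i : forall V, V = U i \/ V = set0 -> diam d V <= delta%:E.
    by move=> V [->//|->]; rewrite diam_set0 leNye.
  have HA : hausdorff_content delta A <= \sum_(i <oo) diam_powR (UA i).
    apply: ereal_inf_lbound; exists UA; split=> //.
      move=> x Ax; have [i _ Uix] := ABU x (or_introl Ax); exists i => //.
      by rewrite /UA; case: pselect => // -[]; exists x.
    by move=> i; apply: (dset i); rewrite /UA; case: pselect; [left|right].
  have HB : hausdorff_content delta B <= \sum_(i <oo) diam_powR (UB i).
    apply: ereal_inf_lbound; exists UB; split=> //.
      move=> x Bx; have [i _ Uix] := ABU x (or_intror Bx); exists i => //.
      rewrite /UB; case: pselect => // -[y [Uiy Ay]]; exfalso.
      have := le_trans (diam_ge Uiy Uix) (dU i); rewrite lee_fin leNgt => /negP; apply.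
      exact: lt_le_trans deta (AB _ _ Ay Bx).
    by move=> i; apply: (dset i); rewrite /UB; case: pselect; [right|left].
  apply: (le_trans (leeD HA HB)).
  rewrite -nneseriesD; do ?by move=> i _ _; exact: diam_powR_ge0.
  apply: lee_nneseries => [i _ _|i _]; first by rewrite adde_ge0 ?diam_powR_ge0.
  by rewrite /UA /UB; case: pselect => ? /=; rewrite diam_powR_set0 ?adde0 ?add0e.
(* The infinite case is split off because the two suprema are treated one at a time, by
   subtraction. *)
have [->|ABoo] := eqVneq (hausdorff d s (A `|` B)) +oo; first exact: leey.
have fAB : hausdorff d s (A `|` B) \is a fin_num.
  by rewrite ge0_fin_numE ?hausdorff_ge0// ltey.
have contentfin delta E : (0 < delta)%R -> E `<=` A `|` B ->
    hausdorff_content delta E \is a fin_num.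
  move=> d0 E_AB; rewrite ge0_fin_numE ?hausdorff_content_ge0//.
  apply: le_lt_trans (content_le_hausdorff E d0) _.
  by apply: le_lt_trans (hausdorff_subset E_AB) _; rewrite ltey.
have fB : hausdorff d s B \is a fin_num.
  rewrite ge0_fin_numE ?hausdorff_ge0//.
  by apply: (@le_lt_trans _ _ (hausdorff d s (A `|` B))); [exact/hausdorff_subset/subsetUr|rewrite ltey].
rewrite -leeBrDr//; rewrite [leLHS]hausdorffE; apply: ge_ereal_sup => _ [d1 [d1_gt0 ->]].
rewrite leeBrDr// -leeBrDl ?contentfin//.
rewrite [leLHS]hausdorffE; apply: ge_ereal_sup => _ [d2 [d2_gt0 ->]].
rewrite leeBrDl ?contentfin//.
(* The two suprema run over unrelated scales [d1] and [d2]; a common smaller scale below [eta] only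
   increases both contents. *)
pose d3 : R := Num.min (Num.min d1 d2) (eta / 2)%R.
have d3_gt0 : (0 < d3)%R by rewrite !lt_min d1_gt0 d2_gt0 divr_gt0.
apply: le_trans (content d3 d3_gt0 _); last first.
  by rewrite /d3 gt_min; apply/orP; right; rewrite ltr_pdivrMr// ltr_pMr// ltr1n.
by apply: leeD; apply: hausdorff_content_scale_le; rewrite /d3 !ge_min lexx ?orbT.
Qed.

Lemma hausdorff_caratheodory_additive (A : nat -> set T) :
  (forall i, (hausdorff d s).-caratheodory (A i)) -> trivIset setT A ->
  hausdorff d s (\bigcup_i A i) = \sum_(i <oo) hausdorff d s (A i).
Proof.
move=> mA tA; apply/eqP; rewrite eq_le hausdorff_sigma_subadditive/=.
have := caratheodory_lime_le mA tA (\bigcup_i A i).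
rewrite setICr outer_measure0 adde0; apply: le_trans.
apply: lee_nneseries => [i _ _|i _]; first exact: hausdorff_ge0.
by apply: hausdorff_subset => x Ax; split=> //; exists i.
Qed.

Hypothesis met : is_metric d.

(* Caratheodory's criterion: with G_ n the points at distance at least 1 / (n + 1)
   from the complement of G, the sets D k = E n (G_ k.+1 \ G_ k) of equal parity are
   mutually separated, so the measures of the D k are summable. *)
Lemma dopen_caratheodory (G : set T) : dopen d G -> (hausdorff d s).-caratheodory G.
Proof.
move=> oG; apply: le_caratheodory_measurable => E.
set mu := (X in X _ + _); rewrite /= -/mu.
have [->|Eoo] := eqVneq (mu E) +oo; first exact: leey.
have fE : mu E \is a fin_num by rewrite ge0_fin_numE ?hausdorff_ge0// ltey.
pose r n : R := (n.+1%:R^-1)%R.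
have r0 n : (0 < r n)%R by rewrite invr_gt0.
have rS n : (r n.+1 < r n)%R by rewrite ltf_pV2 ?posrE// ltr_nat.
pose G_ n := [set x | dball d x (r n) `<=` G].
have GG n : G_ n `<=` G_ n.+1.
  by move=> x xG y xy; apply: xG; exact: lt_trans (rS n).
have GG_le m n : (m <= n)%N -> G_ m `<=` G_ n.
  move=> /subnKC <-; elim: (n - m)%N => [|k ih]; first by rewrite addn0.
  by rewrite addnS; exact: subset_trans (GG _).
pose A n := E `&` G_ n.
pose D n := E `&` (G_ n.+1 `\` G_ n).
(* If d x y were below r n - r n.+1, the ball of radius r n.+1 about y would lie in the ball of
   radius r n about x, hence in G. *)
have sepA n B : (forall y, B y -> ~ G_ n.+1 y) -> separated (r n - r n.+1)%R (A n) B.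
  move=> BG; split; first by rewrite subr_gt0.
  move=> x y [_ xG] /BG yG; rewrite leNgt; apply/negP => xy; apply: yG => z yz.
  apply: xG; rewrite /dball/=; case: met => _ _ _ tri.
  by apply: le_lt_trans (tri x y z) _; move: xy yz; rewrite /dball/=; lra.
have GsubG n : G_ n `<=` G.
  by move=> x; apply; rewrite /dball/=; case: met => _ /(_ x x)[_ ->].
have ->: E `&` ~` G = E `\` G by rewrite setDE.
have main n : mu (A n) + mu (E `\` G) <= mu E.
  have /hausdorff_separated/le_trans : separated (r n - r n.+1)%R (A n) (E `\` G).
    by apply: sepA => y [_ yG] /GsubG.
  by apply; apply: hausdorff_subset => x [[]|[]].
have parity b N : \sum_(k < N) mu (D (2 * k + b)%N) <= mu E.
  suff H : \sum_(k < N) mu (D (2 * k + b)%N) <= mu (\bigcup_(k in `I_N) D (2 * k + b)%N).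
    apply: (le_trans H); apply: hausdorff_subset => x [k _ []] //.
  elim: N => [|N ih]; first by rewrite big_ord0 hausdorff_ge0.
  rewrite big_ord_recr/=; apply: (le_trans (leeD2r _ ih)).
  set B := \bigcup_(k in `I_N) _.
  (* The earlier layers of the same parity stop one layer short of the next one, and that skipped
     layer provides the gap. For N = 0 the union is empty and the predecessor carries no
     information, hence the case split that follows. *)
  have BA : B `<=` A (2 * N + b).-1.
    move=> x [k /= kN [Ex [xG _]]]; split=> //; apply: GG_le xG; lia.
  have sep : separated (r (2 * N + b).-1%N - r (2 * N + b).-1.+1%N)%R B (D (2 * N + b)%N).
    have [NE|N0] := posnP N.
      split; first by rewrite subr_gt0.
      by move=> x y [k /=]; rewrite NE.
    have DG y : D (2 * N + b)%N y -> ~ G_ (2 * N + b).-1.+1%N y.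
      by move=> [_ []]; rewrite prednK//; lia.
    by have [e0 sep] := sepA _ _ DG; split=> // x y /BA; exact: sep.
  apply: (le_trans (hausdorff_separated sep)); apply: hausdorff_subset => x.
  by move=> [[k /= kN Dk]|Dk]; [exists k => //=; exact: ltnW|exists N => /=].
have summable : \sum_(k <oo) mu (D k) <= mu E + mu E.
  have partial N : \sum_(0 <= k < N) mu (D k) <= mu E + mu E.
    apply: (@le_trans _ _ (\sum_(0 <= k < 2 * N) mu (D k))).
      apply: lee_sum_nneg_natr => [k _ _|]; first exact: hausdorff_ge0.
      by rewrite leq_pmull.
    rewrite (_ : \sum_(0 <= k < 2 * N) mu (D k) =
      \sum_(k < N) mu (D (2 * k + 0)%N) + \sum_(k < N) mu (D (2 * k + 1)%N)).
      by apply: leeD; exact: parity.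
    elim: N => [|N ih]; first by rewrite !big_ord0 muln0 big_geq// adde0.
    rewrite !big_ord_recr/= mulnS !big_nat_recr//= ih addn0 addn1.
    by rewrite addeACA -!addeA.
  apply: lime_le; last by apply: nearW.
  by apply: is_cvg_nneseries => *; exact: hausdorff_ge0.
have tail : \sum_(n <= k <oo) mu (D k) @[n --> \oo] --> 0.
  apply: nneseries_tail_cvg => [|k _]; last exact: hausdorff_ge0.
  by apply: (le_lt_trans summable); rewrite ltey_eq fin_numD fE.
have EGsub n : E `&` G `<=` A n `|` \bigcup_(k in ~` `I_n) D k.
  move=> x [Ex Gx].
  have [m xm] : exists m, G_ m x.
    have [e [e0 eG]] := oG _ Gx.
    have [m /= me] := @ltr_add_invr _ 0%R e e0; rewrite add0r in me.
    by exists m => y /lt_trans -/(_ _ me); exact: eG.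
  have [xn|xn] := pselect (G_ n x); [by left; split|right].
  have nm : (n < m)%N by rewrite ltnNge; apply/negP => /GG_le /(_ _ xm).
  pose P k := `[< G_ k x >].
  have exP : exists k, P k by exists m; apply/asboolP.
  case: (ex_minnP exP) => -[|k] /asboolP xk kmin.
    by case: xn; exact: GG_le xk.
  exists k => /=.
    by move=> kn; apply: xn; exact: GG_le xk.
  split=> //; split=> // /asboolP/kmin; by rewrite ltnn.
(* [E & G] exceeds [A n] only by the layers from n on, whose total is the tail of a convergent
   series. *)
have bound n : mu (E `&` G) + mu (E `\` G) <= mu E + \sum_(n <= k <oo) mu (D k).
  have : mu (E `&` G) <= mu (A n) + \sum_(n <= k <oo) mu (D k).
    apply: (le_trans (hausdorff_subset (EGsub n))).
    apply: (le_trans (outer_measureU2 _ _ _)); apply: leeD2l.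
    exact: outer_measure_sigma_subadditive_tail.
  move=> /(leeD2r (mu (E `\` G)))/le_trans; apply.
  by rewrite addeAC; apply: leeD2r; exact: main.
have : mu E + \sum_(n <= k <oo) mu (D k) @[n --> \oo] --> mu E + 0.
  by apply: cvgeD => //; [rewrite fin_num_adde_defr|exact: cvg_cst].
rewrite adde0 => lim; rewrite -(cvg_lim _ lim)//.
by apply: lime_ge; [apply/cvg_ex; exists (mu E)|exact: nearW].
Qed.

Lemma Borel_caratheodory : Borel d `<=` (hausdorff d s).-caratheodory.
Proof.
apply: smallest_sub; last by move=> G; exact: dopen_caratheodory.
split; first exact: caratheodory_measurable_set0.
  by move=> A; rewrite setTD; exact: caratheodory_measurable_setC.
exact: caratheodory_measurable_bigcup.
Qed.

Lemma hausdorff_mm_space :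
  (forall x (r : R), (0 < r)%R -> 0 < hausdorff d s (dball d x r) < +oo) ->
  mm_space d (hausdorff d s).-caratheodory (hausdorff d s).
Proof.
move=> balls; split; split=> //.
- split; first exact: caratheodory_measurable_set0.
    by move=> A; rewrite setTD; exact: caratheodory_measurable_setC.
  exact: caratheodory_measurable_bigcup.
- exact: Borel_caratheodory.
- by move=> A _; exact: hausdorff_ge0.
- exact: hausdorff_caratheodory_additive.
- move=> A B _ A0 BA; apply: le_caratheodory_measurable => X.
  rewrite (_ : _ (X `&` B) = 0) ?add0e.
    by apply: hausdorff_subset; exact: subIsetl.
  apply/eqP; rewrite eq_le hausdorff_ge0 andbT -A0; apply: hausdorff_subset.
  by move=> x [_ /BA].
- by move=> x r r0; apply/andP; exact: balls.
Qed.

End hausdorff_measure.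

(** * The Koch curve and its parametrization *)

Section geometric_limits.
Context {R : realType}.

Lemma geometric_limit_le (x y c k : R) : 0 <= k -> k < 1 ->
  (forall n, x <= y + c * k ^+ n) -> x <= y.
Proof.
move=> k0 k1 xy; have kn : `|k| < 1 by rewrite ger0_norm.
have lim : (y + c * k ^+ n @[n --> \oo] --> y + 0)%R.
  by apply: cvgD; [exact: cvg_cst|exact: cvg_geometric].
rewrite addr0 in lim; rewrite -(cvg_lim _ lim)//.
by apply: limr_ge; [apply/cvg_ex; exists y|exact: nearW].
Qed.

(** The intervals of center x n and radius c n meet pairwise; the supremum of their left ends
    belongs to all of them. *)
Lemma nested_limit (x c : nat -> R) :
  (forall m n, x m - c m <= x n + c n) ->
  exists l, forall n, `|x n - l| <= c n.
Proof.
move=> xc; pose A := [set x n - c n | n in setT].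
have supA : has_sup A.
  split; first by exists (x 0%N - c 0%N), 0%N.
  by exists (x 0%N + c 0%N) => _ [n _ <-].
exists (sup A) => n; rewrite ler_distl; apply/andP; split.
  by rewrite lerBlDr; apply: ge_sup; [case: supA|move=> _ [m _ <-]; exact: xc].
by rewrite -lerBlDr; apply: ub_le_sup; [case: supA|exists n].
Qed.

End geometric_limits.

Section self_similar_limit.
Context {R : realType} {Y A : Type}.
Variables (e : Y -> Y -> R) (g : nat -> Y -> Y) (y0 : Y) (c c' k : R).
Variables (dig : A -> nat) (sh : A -> A).
Hypothesis met : is_metric e.
Hypothesis k0 : 0 <= k.
Hypothesis k1 : k < 1.
Hypothesis complete : forall y : nat -> Y,
  (forall n m, e (y n) (y (n + m)%N) <= c * k ^+ n) ->
  exists l, forall n, e (y n) l <= c' * k ^+ n.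
Hypothesis contraction : forall i y z, e (g i y) (g i z) <= k * e y z.

(** [A] is any type that carries addresses through a first digit [dig] and a shift [sh]. It is used
    in both directions: points as addresses of their parameters, with ratio 1/4, and parameters as
    addresses of points, with ratio 1/3. *)
Fixpoint address_approx n (a : A) : Y :=
  if n is n'.+1 then g (dig a) (address_approx n' (sh a)) else y0.

Lemma address_limit : (forall n a, e y0 (address_approx n a) <= c) ->
  exists phi : A -> Y, (forall a, phi a = g (dig a) (phi (sh a))) /\
    forall n a, e (address_approx n a) (phi a) <= c' * k ^+ n.
Proof.
move=> y0c; have [e0 eE eC tri] := met.
have cauchy n m a : e (address_approx n a) (address_approx (n + m) a) <= c * k ^+ n.
  elim: n a => [|n ih] a; first by rewrite expr0 mulr1.
  apply: (le_trans (contraction _ _ _)).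
  by rewrite exprS mulrCA ler_wpM2l.
have [phi phiP] := choice (fun a => complete (fun n m => cauchy n m a)).
exists phi; split=> // a; apply/eE/eqP; rewrite eq_le e0 andbT.
(* Both sides of the functional equation lie within c' k^(n+1) of the approximation of depth n +
   1. *)
apply: (@geometric_limit_le _ _ _ (2 * c' * k) k) => // n; rewrite add0r.
apply: (le_trans (tri _ (address_approx n.+1 a) _)).
have h1 := phiP a n.+1; rewrite eC in h1.
have h2 : e (address_approx n.+1 a) (g (dig a) (phi (sh a))) <= k * (c' * k ^+ n).
  by apply: (le_trans (contraction _ _ _)); rewrite ler_wpM2l.
by apply: (le_trans (lerD h1 h2)); rewrite exprS le_eqVlt; apply/orP; left; apply/eqP; ring.
Qed.

End self_similar_limit.

(** * The Euclidean distance of the plane *)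

Section euclidean_plane.
Context {R : realType}.
Implicit Types p q : R * R.

Lemma eucl_ge0 p q : 0 <= eucl p q. Proof. exact: sqrtr_ge0. Qed.

Lemma eucl_sqr p q : eucl p q ^+ 2 = (p.1 - q.1) ^+ 2 + (p.2 - q.2) ^+ 2.
Proof. by rewrite sqr_sqrtr// addr_ge0// sqr_ge0. Qed.

Lemma eucl_sym p q : eucl p q = eucl q p.
Proof. by rewrite /eucl -(sqrrN (p.1 - _)) -(sqrrN (p.2 - _)) !opprB. Qed.

Lemma eucl_eq0 p q : eucl p q = 0 <-> p = q.
Proof.
split=> [/eqP|->]; last by rewrite /eucl !subrr !expr0n/= addr0 sqrtr0.
rewrite -sqrf_eq0 eucl_sqr paddr_eq0 ?sqr_ge0// !sqrf_eq0 !subr_eq0.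
by case: p q => [a b] [a' b'] /= /andP[/eqP -> /eqP ->].
Qed.

(** Projection onto a unit vector shortens; by Lagrange's identity the defect of the squares is a
    square. This is the source of lower bounds on distances between cells. *)
Lemma dot_le_eucl (a b : R) p q : a ^+ 2 + b ^+ 2 = 1 ->
  a * (p.1 - q.1) + b * (p.2 - q.2) <= eucl p q.
Proof.
move=> ab; apply: le_trans (ler_norm _) _.
rewrite -(@ler_pXn2r _ 2)// ?nnegrE ?eucl_ge0// eucl_sqr -normrX ger0_norm ?sqr_ge0//.
rewrite -[leRHS]mul1r -ab -subr_ge0.
rewrite (_ : _ - _ = (a * (p.2 - q.2) - b * (p.1 - q.1)) ^+ 2) ?sqr_ge0//.
by ring.
Qed.

Lemma eucl_triangle p q r : eucl p r <= eucl p q + eucl q r.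
Proof.
rewrite -(@ler_pXn2r _ 2)// ?nnegrE ?addr_ge0 ?eucl_ge0//.
set a := p.1 - q.1; set b := p.2 - q.2; set a' := q.1 - r.1; set b' := q.2 - r.2.
have -> : eucl p r ^+ 2 = eucl p q ^+ 2 + eucl q r ^+ 2 + (a * a' + b * b') * 2.
  by rewrite !eucl_sqr /a /b /a' /b'; ring.
suff : a * a' + b * b' <= eucl p q * eucl q r by lra.
apply: le_trans (ler_norm _) _.
rewrite -(@ler_pXn2r _ 2)// ?nnegrE ?mulr_ge0 ?eucl_ge0//.
rewrite -normrX ger0_norm ?sqr_ge0// exprMn !eucl_sqr -subr_ge0.
rewrite (_ : _ - _ = (a * b' - b * a') ^+ 2) ?sqr_ge0//.
by rewrite /a /b /a' /b'; ring.
Qed.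

Lemma eucl_is_metric : is_metric (@eucl R).
Proof.
split; [exact: eucl_ge0|exact: eucl_eq0|exact: eucl_sym|exact: eucl_triangle].
Qed.

Lemma eucl_scale (k : R) p q p' q' : 0 <= k ->
  (p'.1 - q'.1) ^+ 2 + (p'.2 - q'.2) ^+ 2 =
    k ^+ 2 * ((p.1 - q.1) ^+ 2 + (p.2 - q.2) ^+ 2) ->
  eucl p' q' = k * eucl p q.
Proof. by move=> k0 e; rewrite /eucl e sqrtrM ?sqr_ge0// sqrtr_sqr ger0_norm. Qed.

Lemma eucl_le_sum p q : eucl p q <= `|p.1 - q.1| + `|p.2 - q.2|.
Proof.
rewrite -(@ler_pXn2r _ 2)// ?nnegrE ?addr_ge0 ?eucl_ge0// eucl_sqr.
rewrite -(real_normK (num_real (p.1 - _))) -(real_normK (num_real (p.2 - _))).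
by rewrite sqrrD lerD2r lerDl mulrn_wge0// mulr_ge0.
Qed.

Lemma eucl_ge_fst p q : `|p.1 - q.1| <= eucl p q.
Proof.
rewrite ler_norml; apply/andP; split.
  have := @dot_le_eucl (-1) 0 p q; rewrite sqrrN expr1n expr0n/= addr0 => /(_ erefl).
  by rewrite mul0r addr0 mulN1r lerNl.
have := @dot_le_eucl 1 0 p q; rewrite expr1n expr0n/= addr0 => /(_ erefl).
by rewrite mul0r addr0 mul1r.
Qed.

Lemma eucl_ge_snd p q : `|p.2 - q.2| <= eucl p q.
Proof.
rewrite ler_norml; apply/andP; split.
  have := @dot_le_eucl 0 (-1) p q; rewrite sqrrN expr1n expr0n/= add0r => /(_ erefl).
  by rewrite mul0r add0r mulN1r lerNl.
have := @dot_le_eucl 0 1 p q; rewrite expr1n expr0n/= add0r => /(_ erefl).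
by rewrite mul0r add0r mul1r.
Qed.

Lemma eucl_complete (c k : R) (y : nat -> R * R) : 0 <= k -> k <= 1 ->
  (forall n m, eucl (y n) (y (n + m)%N) <= c * k ^+ n) ->
  exists l, forall n, eucl (y n) l <= (2 * c) * k ^+ n.
Proof.
move=> k0 k1 yc.
have c0 n : 0 <= c * k ^+ n by exact: le_trans (eucl_ge0 _ _) (yc n 0%N).
have coord (f : R * R -> R) : (forall p q, `|f p - f q| <= eucl p q) ->
    exists l, forall n, `|f (y n) - l| <= c * k ^+ n.
  move=> fe; apply: nested_limit => m n; rewrite lerBlDr.
  have [mn|/ltnW nm] := leqP m n.
    have := yc m (n - m)%N; rewrite subnKC// => ym.
    have := le_trans (fe _ _) ym; rewrite ler_distl => /andP[_].
    by have := c0 n; lra.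
  have := yc n (m - n)%N; rewrite subnKC// => yn.
  have := le_trans (fe _ _) yn; rewrite ler_distl => /andP[+ _].
  by have := c0 m; lra.
have [l1 l1P] := coord fst eucl_ge_fst.
have [l2 l2P] := coord snd eucl_ge_snd.
exists (l1, l2) => n; apply: (le_trans (eucl_le_sum _ _)) => /=.
by have := l1P n; have := l2P n; lra.
Qed.

End euclidean_plane.

(** * The four similarities and the position of their cells *)

Section koch_parametrization.
Context {R : realType}.
Implicit Types (p q : R * R) (t u : R).
Local Notation sqrt3 := (Num.sqrt (3 : R)).
Local Notation dimpow x := (x `^ snow_dim R).

Lemma sqrt3_sqr : sqrt3 * sqrt3 = 3.
Proof. by rewrite -expr2 sqr_sqrtr. Qed.

Lemma sqrt3_bounds : 1 <= sqrt3 <= 2.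
Proof.
have s0 : 0 <= sqrt3 := sqrtr_ge0 _.
by have s3 := sqrt3_sqr; apply/andP; split; nra.
Qed.

Lemma snow_dim_gt0 : 0 < snow_dim R.
Proof. by rewrite divr_gt0// ln_gt0// ltr1n. Qed.

(** The defining property of the similarity dimension: four copies of ratio 1/3. *)
Lemma dimpow3 : dimpow (3 : R) = 4.
Proof.
rewrite /powR pnatr_eq0/= /snow_dim divfK ?lnK ?posrE//.
by rewrite gt_eqF// ln_gt0// ltr1n.
Qed.

Lemma dimpow_mul3 (x : R) : 0 <= x -> dimpow (3 * x) = 4 * dimpow x.
Proof. by move=> x0; rewrite powRM// dimpow3. Qed.

Lemma dimpow_div3 (x : R) : 0 <= x -> dimpow (x / 3) = dimpow x / 4.
Proof.
move=> x0; have x30 : 0 <= x / 3 by rewrite divr_ge0.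
have := dimpow_mul3 x30; rewrite (_ : 3 * (x / 3) = x); last by field.
by move=> ->; field.
Qed.

Lemma dimpow_exp3 (x : R) n : 0 <= x -> dimpow (3 ^+ n * x) = 4 ^+ n * dimpow x.
Proof.
move=> x0; elim: n => [|n ih]; first by rewrite !expr0 !mul1r.
by rewrite !exprS -!mulrA dimpow_mul3 ?ih// mulr_ge0.
Qed.

Lemma le_dimpow (x y : R) : 0 <= x -> x <= y -> dimpow x <= dimpow y.
Proof.
move=> x0 xy; apply: ge0_ler_powR => //; first exact: ltW snow_dim_gt0.
exact: le_trans xy.
Qed.

Lemma dimpow_div3_1 : dimpow (1 / 3 : R) = 1 / 4.
Proof. by rewrite dimpow_div3// powR1. Qed.

Lemma koch_map_eucl i p q : eucl (koch_map i p) (koch_map i q) = 3^-1 * eucl p q.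
Proof.
apply: eucl_scale; first by rewrite invr_ge0.
have := sqrt3_sqr; case: p q => [a b] [a' b'].
case: i => [|[|[|i]]] /= s3; rewrite /=.
- by field.
- by field: s3.
- by field: s3.
- by field.
Qed.

(* The triangle with base [0, 1] and base angles 30 degrees: it is mapped into itself
   by the four similarities, so it contains the Koch curve. *)
Definition koch_triangle : set (R * R) :=
  [set p | [/\ 0 <= p.2, sqrt3 * p.2 <= p.1 & sqrt3 * p.2 <= 1 - p.1]].

Lemma koch_map_triangle i p : koch_triangle p -> koch_triangle (koch_map i p).
Proof.
have /andP[s1 s2] := sqrt3_bounds.
have := sqrt3_sqr; case: p => [a b] s3 [/= b0 ba ab].
(* The inequalities become linear once the products with [sqrt3] are treated as atoms and the square
   of [sqrt3] is replaced by 3. *)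
have e1 : sqrt3 * (a * sqrt3) = 3 * a by rewrite mulrCA s3 mulrC.
have e2 : 0 <= sqrt3 * b by nra.
have e3 : 0 <= sqrt3 * a by nra.
have e4 : 0 <= sqrt3 * (1 - a) by nra.
have e5 : sqrt3 * sqrt3 * b <= sqrt3 * a by rewrite -mulrA ler_wpM2l// (le_trans _ s1).
have e6 : sqrt3 * sqrt3 * b <= sqrt3 * (1 - a).
  by rewrite -mulrA ler_wpM2l// (le_trans _ s1).
rewrite s3 in e5 e6.
by case: i => [|[|[|i]]]; rewrite /koch_triangle /=; split; lra.
Qed.

Lemma koch_triangle0 : koch_triangle (0, 0).
Proof. by split; rewrite /= ?mulr0 ?subr0. Qed.

Lemma koch_triangle_bounds p : koch_triangle p ->
  [/\ 0 <= p.1, p.1 <= 1, 0 <= p.2 & p.2 <= 1].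
Proof. by have /andP[s1 s2] := sqrt3_bounds; move=> [h1 h2 h3]; split; nra. Qed.

Lemma koch_triangle_eucl p q : koch_triangle p -> koch_triangle q -> eucl p q <= 2.
Proof.
move=> /koch_triangle_bounds[p1 p2 p3 p4] /koch_triangle_bounds[q1 q2 q3 q4].
apply: (le_trans (eucl_le_sum p q)).
suff : `|p.1 - q.1| <= 1 /\ `|p.2 - q.2| <= 1 by move=> []; lra.
by rewrite !ler_norml; split; apply/andP; split; lra.
Qed.

(** The projections to the first axis leave a gap of at least 1/6; the smaller value 1/9 is kept
    because its s-th power is exactly 1/16. *)
Lemma koch_map_far i j p q : (i.+1 < j < 4)%N -> koch_triangle p -> koch_triangle q ->
  1 / 9 <= eucl (koch_map i p) (koch_map j q).
Proof.
move=> ij; have {ij} ijE : (i = 0 /\ j = 2)%N \/ (i = 0 /\ j = 3)%N \/ (i = 1 /\ j = 3)%N.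
  by lia.
move=> Tp Tq; have [p1 p2 p3 p4] := koch_triangle_bounds Tp.
have [q1 q2 q3 q4] := koch_triangle_bounds Tq.
have [_ pa pb] := Tp; have [_ qa qb] := Tq.
have sp : 0 <= sqrt3 * p.2 by rewrite mulr_ge0// sqrtr_ge0.
have sq : 0 <= sqrt3 * q.2 by rewrite mulr_ge0// sqrtr_ge0.
have := le_trans (ler_norm _) (eucl_ge_fst (koch_map j q) (koch_map i p)).
rewrite eucl_sym; apply: le_trans.
case: p q {Tp Tq} p1 p2 p3 p4 q1 q2 q3 q4 pa pb qa qb sp sq => [a b] [a' b'] /=.
by case: ijE => [[-> ->]|[[-> ->]|[-> ->]]] /=; lra.
Qed.

(* Consecutive cells lie in cones with a common vertex which are separated by an angle
   of 60 degrees; the witnesses are the directions of suitable bisectors. *)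
Lemma koch_map_adjacent i p q : (i < 3)%N -> koch_triangle p -> koch_triangle q ->
  1 - p.1 <= 9 * eucl (koch_map i p) (koch_map i.+1 q) /\
  q.1 <= 9 * eucl (koch_map i p) (koch_map i.+1 q).
Proof.
move=> i3 Tp Tq; have [p1 p2 p3 p4] := koch_triangle_bounds Tp.
have [q1 q2 q3 q4] := koch_triangle_bounds Tq.
have [_ pa pb] := Tp; have [_ qa qb] := Tq.
have /andP[s1 s2] := sqrt3_bounds; have s3 := sqrt3_sqr.
rewrite eucl_sym.
(* The directions make angles 0, 60 and 30 degrees, up to sign, with the base. They yield constants
   of at most 6; the value 9 is used because 9^s = 16. *)
have dot a b := @dot_le_eucl _ a b (koch_map i.+1 q) (koch_map i p).
have d10 := dot 1 0; have d60 := dot (1 / 2) (sqrt3 / 2).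
have d60' := dot (1 / 2) (- (sqrt3 / 2)).
have d30 := dot (sqrt3 / 2) (1 / 2); have d30' := dot (sqrt3 / 2) (- (1 / 2)).
have {}d10 := d10 ltac:(by rewrite expr1n expr0n addr0).
have {}d60 := d60 ltac:(by field: s3).
have {}d60' := d60' ltac:(by field: s3).
have {}d30 := d30 ltac:(by field: s3).
have {}d30' := d30' ltac:(by field: s3).
have sp : 0 <= (sqrt3 - 1) * (1 - p.1) by rewrite mulr_ge0 ?subr_ge0.
have sq : 0 <= (sqrt3 - 1) * q.1 by rewrite mulr_ge0 ?subr_ge0.
case: p q {Tp Tq dot p1 p4 q2 q4} p2 q1 p3 q3 pa pb qa qb sp sq d10 d60 d60' d30 d30' =>
  [a b] [a' b'].
have e1 x : sqrt3 * (x * sqrt3) = 3 * x by rewrite mulrCA s3 mulrC.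
have e2 : sqrt3 * sqrt3 = 3 := s3.
have := (e1 a, e1 a', e1 b, e1 b').
move=> [[[ea ea'] eb] eb'].
case: i i3 => [|[|[|i]]]//= _; move: (eucl _ _) => E p2 q1 p3 q3 pa pb qa qb sp sq d10 d60 d60' d30 d30'.
- split; [clear - p2 q1 q3 qa d10; lra|clear - p2 q1 e2 ea ea' eb eb' p3 pa pb d60; lra].
- split; [clear - p2 q1 e2 ea ea' eb eb' p3 q3 sp d30; lra|].
  by clear - p2 q1 e2 ea ea' eb eb' p3 q3 sq d30'; lra.
- split; [clear - p2 q1 e2 ea ea' eb eb' q3 qa qb d60'; lra|clear - p2 q1 p3 pa pb d10; lra].
Qed.

(** The first n digits of some address of p and of some base-4 expansion of t agree, with the
    remainders confined to the triangle and to [0, 1]. Both addresses of a joint are allowed. *)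
Fixpoint koch_rel n p t : Prop :=
  [/\ koch_triangle p, 0 <= t & t <= 1] /\
  if n is n'.+1 then exists i p' t', [/\ (i < 4)%N, p = koch_map i p',
    t = (i%:R + t') / 4 & koch_rel n' p' t'] else True.

Lemma koch_rel_triangle n p t : koch_rel n p t -> [/\ koch_triangle p, 0 <= t & t <= 1].
Proof. by case: n => [|n] []. Qed.

End koch_parametrization.

(** * The Hoelder estimate and the injectivity of the parametrization *)

Section koch_holder.
Context {R : realType}.
Implicit Types (p q : R * R) (t u : R).
Local Notation sqrt3 := (Num.sqrt (3 : R)).
Local Notation dimpow x := (x `^ snow_dim R).

(** If the first digit is 0, both sides are scaled by 1/4. Otherwise p.1 >= 1/3, and the constant 4
    is chosen so that 4 (1/3)^s = 1 >= t. *)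
Lemma koch_rel_start n p t : koch_rel n p t -> t <= 4 * dimpow p.1 + 4^-1 ^+ n.
Proof.
elim: n p t => [|n ih] p t; first by move=> [[_ _ t1] _]; rewrite expr0 ler_wpDl// mulr_ge0// powR_ge0.
move=> [[_ _ t1] [i [p' [t' [i4 pE tE rel]]]]].
have k0 : 0 <= 4^-1 ^+ n.+1 :> R by rewrite exprn_ge0// invr_ge0.
have [Tp' t'0 t'1] := koch_rel_triangle rel.
have [p1 p2 p3 p4] := koch_triangle_bounds Tp'.
have [_ pa pb] := Tp'.
case: i i4 pE tE => [|i] i4 pE tE.
  rewrite tE pE /= dimpow_div3// exprS.
  by have := ih _ _ rel; lra.
suff x3 : 1 / 3 <= p.1.
  have := le_dimpow _ x3; rewrite dimpow_div3_1 => /(_ ltac:(lra)).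
  by move: t1 k0; lra.
have sp : 0 <= sqrt3 * p'.2 by rewrite mulr_ge0// sqrtr_ge0.
clear - pE p1 p2 pa pb sp; case: i pE => [|[|i]] -> /=; lra.
Qed.

Lemma koch_rel_end n p t : koch_rel n p t -> 1 - t <= 4 * dimpow (1 - p.1) + 4^-1 ^+ n.
Proof.
elim: n p t => [|n ih] p t.
  by move=> [[_ t0 _] _]; rewrite expr0 ler_wpDl ?mulr_ge0 ?powR_ge0// gerBl.
move=> [[_ t0 _] [i [p' [t' [i4 pE tE rel]]]]].
have k0 : 0 <= 4^-1 ^+ n.+1 :> R by rewrite exprn_ge0// invr_ge0.
have [Tp' t'0 t'1] := koch_rel_triangle rel.
have [p1 p2 p3 p4] := koch_triangle_bounds Tp'.
have [_ pa pb] := Tp'.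
have [i3|i3] := eqVneq i 3%N.
  rewrite tE pE i3 /= (_ : 1 - (_ + _) = (1 - p'.1) / 3); last by field.
  rewrite dimpow_div3 ?subr_ge0// exprS.
  by have := ih _ _ rel; lra.
suff x3 : 1 / 3 <= 1 - p.1.
  have := le_dimpow _ x3; rewrite dimpow_div3_1 => /(_ ltac:(lra)).
  by move: t0 k0; lra.
have sp : 0 <= sqrt3 * p'.2 by rewrite mulr_ge0// sqrtr_ge0.
have {i4 i3} : (i < 3)%N by lia.
clear - pE p1 p2 pa pb sp; case: i pE => [|[|[|i]]]// -> _ /=; lra.
Qed.

(** Origin of 32: for consecutive cells the difference is ((1 - t) + u) / 4, and each of the two
    terms is at most 4 * 16 E^s up to 4^-n, where E is the distance. For other cells the difference
    is at most 1, while 32 (1/9)^s = 2. *)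
Lemma koch_rel_holder_lt n i j p q t u : (i < j < 4)%N ->
  koch_rel n p t -> koch_rel n q u ->
  (j%:R + u) / 4 - (i%:R + t) / 4 <=
    32 * dimpow (eucl (koch_map i p) (koch_map j q)) + 2 * 4^-1 ^+ n.+1.
Proof.
move=> ij relp relq.
have [Tp t0 t1] := koch_rel_triangle relp.
have [Tq u0 u1] := koch_rel_triangle relq.
have k0 : 0 <= 4^-1 ^+ n.+1 :> R by rewrite exprn_ge0// invr_ge0.
have [jE|jE] := eqVneq j i.+1; last first.
  have ij' : (i.+1 < j < 4)%N by clear - ij jE; lia.
  have := le_dimpow _ (koch_map_far ij' Tp Tq).
  rewrite (_ : 1 / 9 = 1 / 3 / 3 :> R); last by field.
  rewrite dimpow_div3 ?dimpow_div3_1 => [/(_ ltac:(lra)) far|]; last by lra.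
  have j3 : (j%:R : R) <= 3 by rewrite ler_nat; clear - ij; lia.
  have i0 : 0 <= i%:R :> R by [].
  by lra.
have i3 : (i < 3)%N by clear - ij jE; lia.
have [ep eq] := koch_map_adjacent i3 Tp Tq.
rewrite {ij}jE; move: (eucl_ge0 (koch_map i p) (koch_map i.+1 q)) ep eq.
move: (eucl _ _) => E E0 ep eq.
have pow9 x : 0 <= x -> x <= 9 * E -> dimpow x <= 16 * dimpow E.
  move=> x0 /(le_dimpow x0); rewrite (_ : 9 * E = 3 ^+ 2 * E); last by ring.
  by rewrite dimpow_exp3// (_ : 4 ^+ 2 = 16)//; ring.
have [q1 _ _ _] := koch_triangle_bounds Tq.
have [_ p1 _ _] := koch_triangle_bounds Tp.
have hp := koch_rel_end relp; have hq := koch_rel_start relq.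
have := pow9 _ q1 eq; have := pow9 (1 - p.1) ltac:(by rewrite subr_ge0) ep.
rewrite exprS -natr1; move: hp hq; clear; lra.
Qed.

(** Within one cell, distances shrink by 3 and parameters by 4, so the constant survives the
    induction. *)
Lemma koch_rel_holder_step n p q t u : koch_rel n p t -> koch_rel n q u ->
  `|t - u| <= 32 * dimpow (eucl p q) + 2 * 4^-1 ^+ n.
Proof.
elim: n p q t u => [|n ih] p q t u.
  move=> [[_ t0 t1] _] [[_ u0 u1] _]; rewrite expr0.
  have := powR_ge0 (eucl p q) (snow_dim R).
  by rewrite ler_norml => h; apply/andP; split; lra.
move=> [_ [i [p' [t' [i4 -> -> relp]]]]] [_ [j [q' [u' [j4 -> -> relq]]]]].
have aux i1 j1 p1 q1 t1 u1 : (i1 < j1 < 4)%N -> koch_rel n p1 t1 -> koch_rel n q1 u1 ->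
    `|(i1%:R + t1) / 4 - (j1%:R + u1) / 4| <=
      32 * dimpow (eucl (koch_map i1 p1) (koch_map j1 q1)) + 2 * 4^-1 ^+ n.+1.
  move=> ij rp rq; rewrite distrC ger0_norm; first exact: koch_rel_holder_lt.
  have [_ _ t1le] := koch_rel_triangle rp; have [_ u1ge _] := koch_rel_triangle rq.
  have : (i1.+1%:R : R) <= j1%:R by rewrite ler_nat; case/andP: ij.
  by rewrite -natr1; move: t1le u1ge; clear; lra.
have [ij|ji|ij] := ltngtP i j.
- by apply: aux => //; rewrite ij.
- by rewrite distrC eucl_sym; apply: aux => //; rewrite ji.
- rewrite ij koch_map_eucl (mulrC 3^-1) dimpow_div3 ?eucl_ge0// exprS.
  rewrite (_ : _ - _ = (t' - u') / 4); last by ring.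
  rewrite normrM (@ger0_norm _ 4^-1) ?invr_ge0//.
  by have := ih _ _ _ _ relp relq; lra.
Qed.

Definition koch_param p t := forall n, koch_rel n p t.

Lemma koch_param_holder p q t u : koch_param p t -> koch_param q u ->
  `|t - u| <= 32 * dimpow (eucl p q).
Proof.
move=> pt qu; apply: (@geometric_limit_le _ _ _ 2 4^-1); rewrite ?invr_ge0//.
  by rewrite invf_lt1// ltr1n.
by move=> n; exact: koch_rel_holder_step.
Qed.

(** Parameter 0 forces all digits to be 0, which leaves the nested cells around the fixed point of
    the map of index 0. *)
Lemma koch_rel0 n p : koch_rel n p 0 -> eucl p (0, 0) <= 2 * 3^-1 ^+ n.
Proof.
elim: n p => [|n ih] p.
  by move=> [[Tp _ _] _]; rewrite expr0 mulr1; exact: koch_triangle_eucl koch_triangle0.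
move=> [_ [i [p' [t' [i4 -> tE rel]]]]].
have [_ t0 t1] := koch_rel_triangle rel.
have i0 : 0 <= i%:R :> R by [].
have t'0 : t' = 0 by move: tE t0 i0; clear; lra.
have {}i0 : i = 0%N by apply/eqP; rewrite -(@eqr_nat R); apply/eqP; move: tE t0 i0; clear; lra.
rewrite i0 (_ : (0, 0) = koch_map 0 (0, 0)); last by rewrite /= !mul0r.
rewrite koch_map_eucl exprS; rewrite t'0 in rel; have := ih _ rel.
by clear; lra.
Qed.

Lemma koch_rel1 n p : koch_rel n p 1 -> eucl p (1, 0) <= 2 * 3^-1 ^+ n.
Proof.
elim: n p => [|n ih] p.
  move=> [[Tp _ _] _]; rewrite expr0 mulr1; apply: koch_triangle_eucl => //.
  by split; rewrite /= ?mulr0 ?subrr.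
move=> [_ [i [p' [t' [i4 -> tE rel]]]]].
have [_ t0 t1] := koch_rel_triangle rel.
have i3 : i%:R <= 3 :> R by rewrite ler_nat.
have t'1 : t' = 1 by move: tE t1 i3; clear; lra.
have {}i3 : i = 3%N by apply/eqP; rewrite -(@eqr_nat R); apply/eqP; move: tE t1 i3; clear; lra.
rewrite i3 (_ : (1, 0) = koch_map 3 (1, 0)); last by congr pair; rewrite /= ?mul0r//; field.
rewrite koch_map_eucl exprS; rewrite t'1 in rel; have := ih _ rel.
by clear; lra.
Qed.

Lemma koch_map_joint i : (i < 3)%N -> koch_map i (1, 0) = koch_map i.+1 (0, 0) :> R * R.
Proof. by case: i => [|[|[|i]]]// _; congr pair; rewrite /=; field. Qed.

(** Different first digits for the same t are possible only at a joint, with remainders 1 and 0;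
    both points are then close to the common vertex, and 4 = 2 + 2. *)
Lemma koch_rel_inj_step n p q t : koch_rel n p t -> koch_rel n q t ->
  eucl p q <= 4 * 3^-1 ^+ n.
Proof.
elim: n p q t => [|n ih] p q t.
  move=> [[Tp _ _] _] [[Tq _ _] _]; rewrite expr0.
  by apply: (le_trans (koch_triangle_eucl Tp Tq)); rewrite mulr1 ler_nat.
move=> [_ [i [p' [t' [i4 -> -> relp]]]]] [_ [j [q' [u' [j4 -> tE relq]]]]].
have aux i1 j1 p1 q1 t1 u1 : (i1 < j1 < 4)%N -> koch_rel n p1 t1 -> koch_rel n q1 u1 ->
    (i1%:R + t1) / 4 = (j1%:R + u1) / 4 ->
    eucl (koch_map i1 p1) (koch_map j1 q1) <= 4 * 3^-1 ^+ n.+1.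
  move=> ij rp rq e.
  have [_ _ t1le] := koch_rel_triangle rp; have [_ u1ge _] := koch_rel_triangle rq.
  have ij' : (i1.+1%:R : R) <= j1%:R by rewrite ler_nat; case/andP: ij.
  rewrite -natr1 in ij'.
  have t1E : t1 = 1 by move: e t1le u1ge ij'; clear; lra.
  have u1E : u1 = 0 by move: e t1le u1ge ij'; clear; lra.
  have jE : j1 = i1.+1.
    apply/eqP; rewrite -(@eqr_nat R) -natr1; apply/eqP.
    by move: e t1le u1ge ij'; clear; lra.
  rewrite t1E in rp; rewrite u1E in rq.
  have i3 : (i1 < 3)%N by clear - ij jE; lia.
  apply: (le_trans (eucl_triangle _ (koch_map i1 (1, 0)) _)).
  rewrite {2}koch_map_joint// jE !koch_map_eucl [eucl (0, 0) _]eucl_sym exprS.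
  have := koch_rel1 rp; have := koch_rel0 rq; clear; lra.
have [ij|ji|ij] := ltngtP i j.
- by apply: (aux _ _ _ _ _ _ _ relp relq tE); rewrite ij.
- by rewrite eucl_sym; apply: (aux _ _ _ _ _ _ _ relq relp (esym tE)); rewrite ji.
- have tu : t' = u' by rewrite ij in tE; move: tE; clear; lra.
  rewrite ij koch_map_eucl exprS; rewrite -tu in relq.
  by have := ih _ _ _ relp relq; clear; lra.
Qed.

Lemma inv3_lt1 : (3^-1 : R) < 1. Proof. by rewrite invf_lt1// ltr1n. Qed.

Lemma eucl_geometric_eq p q (c : R) : (forall n, eucl p q <= c * 3^-1 ^+ n) -> p = q.
Proof.
move=> pq; apply/eucl_eq0/eqP; rewrite eq_le eucl_ge0 andbT.
apply: (@geometric_limit_le _ _ _ c 3^-1); rewrite ?invr_ge0//; first exact: inv3_lt1.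
by move=> n; rewrite add0r.
Qed.

Lemma koch_param_inj p q t : koch_param p t -> koch_param q t -> p = q.
Proof.
by move=> pt qt; apply: (@eucl_geometric_eq _ _ 4) => n; exact: koch_rel_inj_step (pt n) (qt n).
Qed.

Lemma koch_param0 p : koch_param p 0 -> p = (0, 0).
Proof.
by move=> p0; apply: (@eucl_geometric_eq _ _ 2) => n; exact: koch_rel0 (p0 n).
Qed.

Lemma koch_param1 p : koch_param p 1 -> p = (1, 0).
Proof.
by move=> p1; apply: (@eucl_geometric_eq _ _ 2) => n; exact: koch_rel1 (p1 n).
Qed.

End koch_holder.

(** * Existence of a parameter for each point and of a point for each parameter *)

Section koch_curve_param.
Context {R : realType}.
Implicit Types (p q : R * R) (t u : R).
Local Notation sqrt3 := (Num.sqrt (3 : R)).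
Local Notation orbit w := (foldr (@koch_map R) (0, 0) w).

Lemma koch_map_surj i p : exists q, koch_map i q = p.
Proof.
have s3 := @sqrt3_sqr R; case: p => [x y].
case: i => [|[|[|i]]].
- by exists (3 * x, 3 * y); congr pair; rewrite /=; field.
- exists (3 * ((x - 1 / 3) / 2 + y * sqrt3 / 2), 3 * (y / 2 - (x - 1 / 3) * sqrt3 / 2)).
  by congr pair; rewrite /=; field: s3.
- exists (3 * ((x - 1 / 2) / 2 - (y - sqrt3 / 6) * sqrt3 / 2),
          3 * ((y - sqrt3 / 6) / 2 + (x - 1 / 2) * sqrt3 / 2)).
  by congr pair; rewrite /=; field: s3.
- by exists (3 * (x - 2 / 3), 3 * y); congr pair; rewrite /=; field.
Qed.

Lemma koch_orbit_triangle w : koch_triangle (orbit w).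
Proof. by elim: w => [|i w ih] /=; [exact: koch_triangle0|exact: koch_map_triangle]. Qed.

Lemma koch_curve_map i p : koch_curve p -> koch_curve (koch_map i p).
Proof.
move=> Kp eps eps0; have [w wp] := Kp eps eps0; exists (i :: w) => /=.
by rewrite koch_map_eucl; have := eucl_ge0 p (orbit w); lra.
Qed.

(** The triangle contains the orbit and is closed; 3 is a bound for 1 + [sqrt3]. *)
Lemma koch_curve_triangle p : koch_curve p -> koch_triangle p.
Proof.
have /andP[s1 s2] := @sqrt3_bounds R; move=> Kp.
have small (x : R) : (forall eps, 0 < eps -> x <= 3 * eps) -> x <= 0.
  move=> xe; rewrite leNgt; apply/negP => x0.
  have := xe (x / 6); lra.
split; rewrite -subr_le0 ?sub0r; apply: small => eps eps0.
all: have [w wp] := Kp eps eps0.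
all: have [h1 h2 h3] := koch_orbit_triangle w.
all: have := le_trans (eucl_ge_fst p (orbit w)) (ltW wp).
all: have := le_trans (eucl_ge_snd p (orbit w)) (ltW wp).
all: rewrite !ler_norml => /andP[d1 d2] /andP[d3 d4].
- by lra.
- have : sqrt3 * (p.2 - (orbit w).2) <= 2 * eps by nra.
  by lra.
- have : sqrt3 * (p.2 - (orbit w).2) <= 2 * eps by nra.
  by lra.
Qed.

(** Digits above 3 act like 3, and the empty word may be prefixed by 0 because (0, 0) is fixed by
    the map of index 0. *)
Lemma koch_orbit_cons w : exists i w', (i < 4)%N /\ orbit w = koch_map i (orbit w').
Proof.
case: w => [|i w]; first by exists 0%N, [::]; split=> //=; rewrite !mul0r.
by case: i => [|[|[|i]]]; [exists 0%N|exists 1%N|exists 2%N|exists 3%N]; exists w.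
Qed.

(** If no preimage of p were on the curve, each of the four would keep a positive distance from the
    orbit, and a third of the smallest one would keep p away from the orbit. *)
Lemma koch_curve_split p : koch_curve p ->
  exists i q, [/\ (i < 4)%N, koch_curve q & p = koch_map i q].
Proof.
move=> Kp; apply: contrapT => nK.
have [q qP] := choice (fun i => koch_map_surj i p).
have far i : exists e : R, 0 < e /\ ((i < 4)%N -> forall w, e <= eucl (q i) (orbit w)).
  have [i4|] := ltnP i 4; last by exists 1.
  have /existsNP[e /not_implyP[e0 /forallNP we]] : ~ koch_curve (q i).
    by move=> Kq; apply: nK; exists i, (q i).
  by exists e; split=> // _ w; rewrite leNgt; apply/negP; exact: we.
have [e eP] := choice far.
pose m := Num.min (Num.min (e 0%N) (e 1%N)) (Num.min (e 2%N) (e 3%N)).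
have e0 i : 0 < e i by case: (eP i).
have m0 : 0 < m / 3 by rewrite divr_gt0// /m !lt_min !e0.
have [w] := Kp _ m0; have [i [w' [i4 ->]]] := koch_orbit_cons w.
rewrite -(qP i) koch_map_eucl mulrC ltr_pM2r ?invr_gt0// ltNge => /negP; apply.
have [_ /(_ i4 w')] := eP i; apply: le_trans.
by case: i i4 => [|[|[|[|i]]]]//= _; rewrite /m !ge_min lexx ?orbT.
Qed.

Lemma dist_is_metric : is_metric (fun x y : R => `|x - y|).
Proof.
split=> [x y|x y|x y|x y z] //.
- by split=> [/normr0_eq0/eqP|->]; rewrite ?subrr ?normr0// subr_eq0 => /eqP.
- exact: distrC.
- by rewrite (le_trans _ (ler_normD _ _))// addrA subrK.
Qed.

Lemma dist_complete (c k : R) (y : nat -> R) :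
  (forall n m, `|y n - y (n + m)%N| <= c * k ^+ n) ->
  exists l, forall n, `|y n - l| <= c * k ^+ n.
Proof.
move=> yc; have c0 n : 0 <= c * k ^+ n by exact: le_trans (yc n 0%N).
apply: nested_limit => m n; have := c0 n; have := c0 m.
have [mn|/ltnW nm] := leqP m n.
  have := yc m (n - m)%N; rewrite subnKC// ler_distl => /andP[_]; lra.
have := yc n (m - n)%N; rewrite subnKC// ler_distl => /andP[+ _]; lra.
Qed.

(** Points serve as addresses: a chosen cell gives the digit and the preimage in it gives the shift,
    so the parameter is the limit of the base-4 expansion. *)
Lemma koch_curve_param p : koch_curve p -> exists t, koch_param p t.
Proof.
(* Off the curve the default digit is 0, so that all digits are below 4 and all approximations stay
   in [0, 1]. *)
have split_total q : exists iq' : nat * (R * R), (iq'.1 < 4)%N /\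
    (koch_curve q -> koch_curve iq'.2 /\ q = koch_map iq'.1 iq'.2).
  have [Kq|nKq] := pselect (koch_curve q); last by exists (0%N, q).
  by have [i [q' [i4 Kq' qE]]] := koch_curve_split Kq; exists (i, q').
have [f fP] := choice split_total.
pose dig q := (f q).1; pose sh q := (f q).2.
pose g (i : nat) (t : R) := (i%:R + t) / 4.
have inv4_ge0 : 0 <= 4^-1 :> R by rewrite invr_ge0.
have inv4_lt1 : 4^-1 < 1 :> R by rewrite invf_lt1// ltr1n.
have unit n q : 0 <= address_approx g 0 dig sh n q <= 1.
  elim: n q => [|n ih] q /=; first by rewrite lexx ler01.
  have /andP[h0 h1] := ih (sh q).
  have : ((dig q)%:R : R) <= 3 by rewrite ler_nat -ltnS; case: (fP q).
  have : 0 <= (dig q)%:R :> R by [].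
  by rewrite /g => d0 d3; apply/andP; split; lra.
have contr i y z : `|g i y - g i z| <= 4^-1 * `|y - z|.
  rewrite /g (_ : _ - _ = 4^-1 * (y - z)); last by ring.
  by rewrite normrM (ger0_norm inv4_ge0).
have [|phi [phiE phi_lim]] := address_limit dist_is_metric inv4_ge0 inv4_lt1
  (@dist_complete 1 4^-1) contr (y0 := 0) (dig := dig) (sh := sh).
  by move=> n a; have /andP[h0 h1] := unit n a; rewrite sub0r normrN ger0_norm.
have phi01 q : 0 <= phi q <= 1.
  apply/andP; split; apply: (@geometric_limit_le _ _ _ 1 4^-1) => // n;
    have := phi_lim n q; have /andP[h0 h1] := unit n q;
    rewrite ler_distl => /andP[]; lra.
move=> Kp; exists (phi p) => n; elim: n p Kp => [|n ih] p Kp; have /andP[h0 h1] := phi01 p.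
  by split=> //; split=> //; exact: koch_curve_triangle.
split; first by split=> //; exact: koch_curve_triangle.
have [i4 /(_ Kp)[Kq pE]] := fP p.
by exists (dig p), (sh p), (phi (sh p)); split=> //; exact: ih.
Qed.

(** Base-4 digits of t give the address; the approximations are orbit points, so their limit is on
    the curve. *)
Lemma unit_interval_param t : 0 <= t <= 1 ->
  exists p, koch_curve p /\ koch_param p t.
Proof.
have split_total u : exists iu' : nat * R, (iu'.1 < 4)%N /\
    (0 <= u <= 1 -> 0 <= iu'.2 <= 1 /\ u = (iu'.1%:R + iu'.2) / 4).
  have [u1|u1] := leP u (1 / 4).
    by exists (0%N, 4 * u); split=> //= /andP[u0 _]; split; [apply/andP; split|]; lra.
  have [u2|u2] := leP u (2 / 4).
    by exists (1%N, 4 * u - 1); split=> //= _; split; [apply/andP; split|]; lra.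
  have [u3|u3] := leP u (3 / 4).
    by exists (2%N, 4 * u - 2); split=> //= _; split; [apply/andP; split|]; lra.
  by exists (3%N, 4 * u - 3); split=> //= /andP[_ u4]; split; [apply/andP; split|]; lra.
have [f fP] := choice split_total.
pose dig u := (f u).1; pose sh u := (f u).2.
have inv3_ge0 : 0 <= 3^-1 :> R by rewrite invr_ge0.
have approx_orbit n u : exists w, address_approx (@koch_map R) (0, 0) dig sh n u = orbit w.
  elim: n u => [|n ih] u; first by exists [::].
  by have [w wE] := ih (sh u); exists (dig u :: w) => /=; rewrite wE.
have contr i p q : eucl (koch_map i p) (koch_map i q) <= 3^-1 * eucl p q.
  by rewrite koch_map_eucl.
have compl := fun y => @eucl_complete R 2 3^-1 y inv3_ge0 (ltW inv3_lt1).
have [|phi [phiE phi_lim]] := address_limit eucl_is_metric inv3_ge0 inv3_lt1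
  compl contr (y0 := (0, 0)) (dig := dig) (sh := sh).
  move=> n u; have [w ->] := approx_orbit n u.
  by apply: koch_triangle_eucl; [exact: koch_triangle0|exact: koch_orbit_triangle].
have Kphi u : koch_curve (phi u).
  move=> eps eps0.
  have [n ne] : exists n, 2 * 2 * 3^-1 ^+ n < eps.
    apply: contrapT => /forallNP H.
    have : eps <= 0 by apply: (@geometric_limit_le _ _ _ (2 * 2) 3^-1) => //;
      [exact: inv3_lt1|move=> n; rewrite add0r leNgt; apply/negP; exact: H].
    by rewrite leNgt eps0.
  have [w wE] := approx_orbit n u; exists w; rewrite -wE eucl_sym.
  exact: le_lt_trans (phi_lim n u) ne.
move=> t01; exists (phi t); split=> // n; elim: n t t01 => [|n ih] t t01.
  by split=> //; split=> //; [exact: koch_curve_triangle|case/andP: t01|case/andP: t01].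
split; first by split=> //; [exact: koch_curve_triangle|case/andP: t01|case/andP: t01].
have [i4 /(_ t01)[u01 uE]] := fP t.
by exists (dig t), (phi (sh t)), (sh t); split=> //; exact: ih.
Qed.

End koch_curve_param.

(** * The snowflake *)

Section snowflake.
Context {R : realType}.
Implicit Types (p q z w : R * R) (t u : R).
Local Notation sqrt3 := (Num.sqrt (3 : R)).
Local Notation dimpow x := (x `^ snow_dim R).

(** The arithmetic is left in the unreduced form that [sim_image] produces, so the sides of
    [snowflake] match by conversion. *)
Definition side_map (j : nat) z : R * R :=
  match j with
  | 0%N => z
  | 1%N => (1 + (- (1 / 2) * z.1 - - (sqrt3 / 2) * z.2),
            0 + (- (1 / 2) * z.2 + - (sqrt3 / 2) * z.1))
  | _ => (1 / 2 + (- (1 / 2) * z.1 - sqrt3 / 2 * z.2),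
          - (sqrt3 / 2) + (- (1 / 2) * z.2 + sqrt3 / 2 * z.1))
  end.

Lemma snowflakeP p : snowflake p <->
  exists j z, [/\ (j < 3)%N, koch_curve z & p = side_map j z].
Proof.
split=> [[[Kp|[z Kz <-]]|[z Kz <-]]|[j [z [j3 Kz ->]]]].
- by exists 0%N, p.
- by exists 1%N, z.
- by exists 2%N, z.
- case: j j3 => [|[|[|j]]]// _; [by left; left|left; right|right]; by exists z.
Qed.

Lemma side_map_eucl j p q : eucl (side_map j p) (side_map j q) = eucl p q.
Proof.
have s3 := @sqrt3_sqr R; rewrite -[RHS]mul1r; apply: eucl_scale => //.
case: p q => [a b] [a' b']; case: j => [|[|j]] /=.
- by ring.
- by field: s3.
- by field: s3.
Qed.

(* Two consecutive sides form a copy of the two middle cells of the Koch curve. *)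
Lemma side_map_next j p q : (j < 3)%N ->
  eucl (side_map j p) (side_map (j.+1 %% 3) q) = 3 * eucl (koch_map 1 p) (koch_map 2 q).
Proof.
move=> j3; have s3 := @sqrt3_sqr R; apply: eucl_scale => //.
case: p q => [a b] [a' b']; case: j j3 => [|[|[|j]]]// _; rewrite ?modnn ?modn_small//=.
- by field: s3.
- by field: s3.
- by field: s3.
Qed.

Lemma koch_param_map i z t : (i < 4)%N -> koch_param z t ->
  koch_param (koch_map i z) ((i%:R + t) / 4).
Proof.
move=> i4 zt n; have [Tz t0 t1] := koch_rel_triangle (zt 0%N).
have i3 : (i%:R : R) <= 3 by rewrite ler_nat.
have i0 : 0 <= i%:R :> R by [].
have base : [/\ koch_triangle (koch_map i z), 0 <= (i%:R + t) / 4 & (i%:R + t) / 4 <= 1].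
  by split; [exact: koch_map_triangle|move: t0 i0; clear; lra|move: t1 i3; clear; lra].
by case: n => [|n]; split=> //; exists i, z, t; split=> //; exact: zt.
Qed.

Lemma koch_param_unit z t : koch_param z t -> 0 <= t <= 1.
Proof. by move=> /(_ 0%N)/koch_rel_triangle[_ -> ->]. Qed.

(** In the two middle cells the parameters (1 + t) / 4 and (2 + u) / 4 differ by ((1 - t) + u) / 4;
    the factor 4 is absorbed by 3^s, which leaves the constant 32. *)
Lemma side_next_holder j z w t u : (j < 3)%N -> koch_param z t -> koch_param w u ->
  (1 - t) + u <= 32 * dimpow (eucl (side_map j z) (side_map (j.+1 %% 3) w)).
Proof.
move=> j3 zt wu; rewrite side_map_next// dimpow_mul3 ?eucl_ge0//.
have := koch_param_holder (koch_param_map (isT : (1 < 4)%N) zt)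
  (koch_param_map (isT : (2 < 4)%N) wu).
have := powR_ge0 (eucl (koch_map 1 z) (koch_map 2 w)) (snow_dim R).
by rewrite ler_distl => h /andP[h1 h2]; move: h h1; clear; lra.
Qed.

(* The snowflake is parametrized by the boundary of the triangle with vertices
   (0, 0), (1, 0), (0, 1). *)
Definition snow_coord (j : nat) t : R * R :=
  match j with 0%N => (t, 0) | 1%N => (1 - t, t) | _ => (0, 1 - t) end.

Definition snow_param p (c : R * R) := exists j z t,
  [/\ (j < 3)%N, koch_param z t, p = side_map j z & c = snow_coord j t].

Lemma mod3_consecutive (j k : nat) : (j < 3)%N -> (k < 3)%N -> j != k ->
  (k = j.+1 %% 3)%N \/ (j = k.+1 %% 3)%N.
Proof.
by case: j k => [|[|[|j]]] [|[|[|k]]]//= _ _ _;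
  [left|right|right|left|left|right].
Qed.

(** On one side each coordinate moves by at most |t - u|. Any two distinct sides are consecutive in
    some order, and between them each coordinate moves by at most (1 - t) + u. *)
Lemma snow_param_holder p q c c' : snow_param p c -> snow_param q c' ->
  `|c.1 - c'.1| <= 32 * dimpow (eucl p q) /\ `|c.2 - c'.2| <= 32 * dimpow (eucl p q).
Proof.
move=> [j [z [t [j3 zt -> ->]]]] [k [w [u [k3 wu -> ->]]]].
have /andP[t0 t1] := koch_param_unit zt; have /andP[u0 u1] := koch_param_unit wu.
have same := koch_param_holder zt wu.
have pow0 := powR_ge0 (eucl (side_map j z) (side_map k w)) (snow_dim R).
have [jk|jk] := eqVneq j k.
  rewrite -jk side_map_eucl; rewrite ler_distl in same; case/andP: same => s1 s2.
  rewrite -jk side_map_eucl in pow0.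
  case: j {j3 jk} => [|[|j]] /=; rewrite !ler_norml; split; apply/andP; split;
    by move: s1 s2 pow0; clear; lra.
have [kE|jE] := mod3_consecutive j3 k3 jk.
- have := side_next_holder j3 zt wu; rewrite -kE.
  move: (32 * _) => B h; rewrite !ler_norml.
  case: j j3 kE {jk same pow0} => [|[|[|j]]]// _ ->; rewrite ?modnn ?modn_small//=;
    split; apply/andP; split; by move: t0 t1 u0 u1 h; clear; lra.
- have := side_next_holder k3 wu zt; rewrite -jE eucl_sym.
  move: (32 * _) => B h; rewrite !ler_norml.
  case: k k3 jE {jk same pow0} => [|[|[|k]]]// _ ->; rewrite ?modnn ?modn_small//=;
    split; apply/andP; split; by move: t0 t1 u0 u1 h; clear; lra.
Qed.

Lemma side_map_corner j : (j < 3)%N -> side_map j (1, 0) = side_map (j.+1 %% 3) (0, 0).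
Proof.
case: j => [|[|[|j]]]// _; rewrite ?modnn ?modn_small//=; congr pair;
  rewrite ?mulr0 ?mulr1; by field.
Qed.

Lemma snow_coord_next_inj j z w t u : (j < 3)%N -> koch_param z t -> koch_param w u ->
  snow_coord j t = snow_coord (j.+1 %% 3) u -> side_map j z = side_map (j.+1 %% 3) w.
Proof.
move=> j3 zt wu e.
have [t1 u0] : t = 1 /\ u = 0.
  case: j j3 e => [|[|[|j]]]// _; rewrite ?modnn ?modn_small//= => -[];
  by split; lra.
by rewrite t1 in zt; rewrite u0 in wu; rewrite (koch_param1 zt) (koch_param0 wu) side_map_corner.
Qed.

Lemma snow_param_inj p q c : snow_param p c -> snow_param q c -> p = q.
Proof.
move=> [j [z [t [j3 zt -> ->]]]] [k [w [u [k3 wu -> e]]]].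
have [jk|jk] := eqVneq j k.
  rewrite -jk in e *; suff tu : t = u by rewrite -tu in wu; rewrite (koch_param_inj zt wu).
  by case: j {j3 jk} e => [|[|j]] /= []; lra.
have [kE|jE] := mod3_consecutive j3 k3 jk.
- by rewrite kE in e *; exact: snow_coord_next_inj zt wu e.
- by rewrite jE in e *; apply/esym; exact: snow_coord_next_inj wu zt (esym e).
Qed.

Lemma snow_param_total (x : snowT R) : exists c, snow_param (sval x) c.
Proof.
case: x => p /= /snowflakeP[j [z [j3 Kz ->]]].
by have [t zt] := koch_curve_param Kz; exists (snow_coord j t), j, z, t.
Qed.

(* The exponent of the Hoelder condition exceeds 1. *)
Lemma holder_dimpow_const (f : R -> R) (l C : R) :
  (forall a b, 0 <= a -> a <= b -> b <= l -> `|f a - f b| <= C * dimpow (b - a)) ->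
  forall t, 0 <= t -> t <= l -> f 0 = f t.
Proof.
move=> fC t t0 tl.
(* Cutting into thirds replaces the bound by three bounds a quarter as large, which gives the factor
   3/4. *)
have iter n a b : 0 <= a -> a <= b -> b <= l ->
    `|f a - f b| <= C * dimpow (b - a) * (3 / 4) ^+ n.
  elim: n a b => [|n ih] a b a0 ab bl; first by rewrite expr0 mulr1 fC.
  set a1 := a + (b - a) / 3; set a2 := a + (b - a) * 2 / 3.
  have i1 : `|f a - f a1| <= C * dimpow ((b - a) / 3) * (3 / 4) ^+ n.
    by rewrite (_ : (b - a) / 3 = a1 - a); [apply: ih; rewrite /a1; lra|rewrite /a1; ring].
  have i2 : `|f a1 - f a2| <= C * dimpow ((b - a) / 3) * (3 / 4) ^+ n.
    rewrite (_ : (b - a) / 3 = a2 - a1); last by rewrite /a1 /a2; field.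
    by apply: ih; rewrite /a1 /a2; lra.
  have i3 : `|f a2 - f b| <= C * dimpow ((b - a) / 3) * (3 / 4) ^+ n.
    by rewrite (_ : (b - a) / 3 = b - a2); [apply: ih; rewrite /a2; lra|rewrite /a2; field].
  rewrite dimpow_div3 ?subr_ge0// in i1 i2 i3.
  rewrite (_ : f a - f b = (f a - f a1) + (f a1 - f a2) + (f a2 - f b)); last by ring.
  apply: (le_trans (ler_normD _ _)); apply: (le_trans (lerD (ler_normD _ _) (lexx _))).
  by apply: (le_trans (lerD (lerD i1 i2) i3)); rewrite exprS; clear; lra.
apply/eqP; rewrite -subr_eq0 -normr_eq0 eq_le normr_ge0 andbT.
apply: (@geometric_limit_le _ _ _ (C * dimpow (t - 0)) (3 / 4)); try lra.
by move=> n; rewrite add0r; exact: iter.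
Qed.

Lemma snow_sval_inj (x y : snowT R) : sval x = sval y -> x = y.
Proof.
by case: x y => [p Hp] [q Hq] /= pq; subst q; rewrite (Prop_irrelevance Hp Hq).
Qed.

Lemma snow_d_is_metric : is_metric (@snow_d R).
Proof.
have [e0 eE eC etri] := @eucl_is_metric R.
split=> [x y|x y|x y|x y z]; rewrite /snow_d//.
by split=> [/eE|->]; [exact: snow_sval_inj|exact/eE].
Qed.

Lemma snow_no_arc_curve (gam : R -> snowT R) l : ~ arc_curve (@snow_d R) gam l.
Proof.
move=> ag; have [c cP] := choice snow_param_total.
have holder a b : 0 <= a -> a <= b -> b <= l ->
    `|(c (gam a)).1 - (c (gam b)).1| <= 32 * dimpow (b - a) /\
    `|(c (gam a)).2 - (c (gam b)).2| <= 32 * dimpow (b - a).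
  move=> a0 ab bl; have [h1 h2] := snow_param_holder (cP (gam a)) (cP (gam b)).
  have le32 : 32 * dimpow (eucl (sval (gam a)) (sval (gam b))) <= 32 * dimpow (b - a).
    rewrite ler_pM2l//; apply: le_dimpow; first exact: eucl_ge0.
    exact: arc_curve_lipschitz ag a0 ab bl.
  by split; [exact: le_trans le32|exact: le_trans le32].
have const t : 0 <= t -> t <= l -> gam t = gam 0.
  move=> t0 tl; apply/snow_sval_inj/(snow_param_inj (cP _)).
  rewrite [c (gam t)]surjective_pairing.
  rewrite -(@holder_dimpow_const (fun t => (c (gam t)).1) l 32 _ t t0 tl); last first.
    by move=> a b a0 ab bl; have [] := holder _ _ a0 ab bl.
  rewrite -(@holder_dimpow_const (fun t => (c (gam t)).2) l 32 _ t t0 tl); last first.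
    by move=> a b a0 ab bl; have [] := holder _ _ a0 ab bl.
  by rewrite -surjective_pairing; exact: cP.
have [l0 len] := ag; have := len 0 l (lexx 0) (ltW l0) (lexx l); rewrite subr0 => lenE.
suff : (l%:E <= 0)%E by rewrite lee_fin leNgt l0.
rewrite -lenE; apply: ge_ereal_sup => _ [n [s [s0 sn smon ->]]].
have s_ge i : (i <= n)%N -> 0 <= s i.
  elim: i => [|i ih] i_n; first by rewrite s0.
  exact: le_trans (ih (ltnW i_n)) (smon _ i_n).
(* Indexed by n - i so that the induction descends from the last node, s n = l. *)
have s_le i : (i <= n)%N -> s (n - i)%N <= l.
  elim: i => [|i ih] i_n; first by rewrite subn0 sn.
  apply: le_trans (ih (ltnW i_n)); rewrite -[leRHS]/(s (n - i)%N).
  have := smon (n - i.+1)%N; rewrite subnSK//; apply; lia.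
rewrite big1// => i _; rewrite !const.
- by have [_ dE _ _] := snow_d_is_metric; exact/dE.
- by apply: s_ge; exact: ltn_ord.
- by have := s_le (n - i.+1)%N; rewrite subKn ?leq_subr; [apply|exact: ltn_ord].
- by apply: s_ge; exact: ltnW.
- by have := s_le (n - i)%N; rewrite subKn ?leq_subr; [apply|exact: ltnW].
Qed.

End snowflake.

(** * The Hausdorff measure of the snowflake: bounds and null sets *)

Section snowflake_measure.
Context {R : realType}.
Local Notation dimpow x := (x `^ snow_dim R).

Lemma koch_word_eucl (w : seq nat) (p q : R * R) :
  eucl p q = 3 ^+ size w * eucl (foldr (@koch_map R) p w) (foldr (@koch_map R) q w).
Proof.
elim: w => [|i w ih] /=; first by rewrite expr0 mul1r.
by rewrite ih koch_map_eucl exprS; field.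
Qed.

Lemma koch_word_curve (w : seq nat) (p : R * R) : koch_curve p ->
  koch_curve (foldr (@koch_map R) p w).
Proof. by move=> Kp; elim: w => [//|i w ih] /=; exact: koch_curve_map. Qed.

Lemma koch_curve_word n (p : R * R) : koch_curve p ->
  exists w q, [/\ size w = n, koch_curve q & p = foldr (@koch_map R) q w].
Proof.
elim: n p => [|n ih] p Kp; first by exists [::], p.
have [i [p' [_ Kp' pE]]] := koch_curve_split Kp.
by have [w [q [wn Kq p'E]]] := ih _ Kp'; exists (i :: w), q; rewrite /= wn pE p'E.
Qed.

Lemma geometric_lt (c k eps : R) : 0 <= k -> k < 1 -> 0 < eps ->
  exists n, c * k ^+ n < eps.
Proof.
move=> k0 k1 eps0; apply: contrapT => /forallNP H.
have : eps <= 0 by apply: (@geometric_limit_le _ _ _ c k) => // n;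
  rewrite add0r leNgt; apply/negP; exact: H.
by rewrite leNgt eps0.
Qed.

Lemma diam_dimpow (U : set (snowT R)) x y : U x -> U y ->
  (diam (@snow_d R) U <= 1%:E)%E ->
  ((dimpow (snow_d x y))%:E <= diam_powR (@snow_d R) (snow_dim R) U)%E.
Proof.
move=> Ux Uy U1; rewrite lee_fin; apply: le_dimpow; first exact: eucl_ge0.
have le := diam_ge (@snow_d R) Ux Uy.
rewrite -lee_fin fineK// fin_real//.
by rewrite (lt_le_trans _ le) ?ltNyr// (le_lt_trans U1) ?ltry.
Qed.

(* The parameters of the points in one covering set lie in an interval whose length is
   controlled by the diameter, and the parameters of a cell fill [0, 1]. *)
Lemma snow_ball_gt0 (x : snowT R) (r : R) : 0 < r ->
  (0 < @snow_mu R (dball (@snow_d R) x r))%E.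
Proof.
move=> r0; have [j [z [j3 Kz xE]]] := (snowflakeP (sval x)).1 (svalP x).
(* Cells of depth n have diameter at most 2 * 3^-n, so the whole cell around x fits in the ball. *)
have [n n_r] := @geometric_lt 2 3^-1 r ltac:(by rewrite invr_ge0) inv3_lt1 r0.
have [w [z' [wn Kz' zE]]] := koch_curve_word n Kz.
have param (t : R) : exists p : R * R, 0 <= t <= 1 -> koch_curve p /\ koch_param p t.
  have [t01|] := boolP (0 <= t <= 1); last by exists (0, 0).
  by have [p pP] := unit_interval_param t01; exists p.
have [phi phiP] := choice param.
have point (t : R) : exists y : snowT R, 0 <= t <= 1 ->
    sval y = side_map j (foldr (@koch_map R) (phi t) w).
  have [t01|] := boolP (0 <= t <= 1); last by exists x.
  have sf : snowflake (side_map j (foldr (@koch_map R) (phi t) w)).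
    apply/snowflakeP; exists j, (foldr (@koch_map R) (phi t) w); split=> //.
    by apply: koch_word_curve; case: (phiP t t01).
  by exists (exist _ _ sf).
have [y yP] := choice point.
have y_ball t : 0 <= t <= 1 -> dball (@snow_d R) x r (y t).
  move=> t01; rewrite /dball /= /snow_d xE (yP t t01) side_map_eucl zE.
  apply: le_lt_trans n_r.
  have := koch_word_eucl w z' (phi t); rewrite wn => /esym e.
  have [Kphi _] := phiP t t01.
  have := koch_triangle_eucl (koch_curve_triangle Kz') (koch_curve_triangle Kphi).
  by rewrite -e exprVn ler_pdivlMr ?exprn_gt0// mulrC.
pose C : R := 32 * 4 ^+ n.
(* [C] is the Hoelder constant for parameters local to the cell: enlarging the cell by 3^n
   multiplies the s-th power of distances by 4^n. *)
have C0 : 0 < C by rewrite mulr_gt0// exprn_gt0.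
have y_holder t u : 0 <= t <= 1 -> 0 <= u <= 1 ->
    `|t - u| <= C * dimpow (snow_d (y t) (y u)).
  move=> t01 u01; have [_ pt] := phiP t t01; have [_ pu] := phiP u u01.
  have := koch_param_holder pt pu; rewrite (koch_word_eucl w) wn dimpow_exp3 ?eucl_ge0//.
  by rewrite /snow_d (yP t t01) (yP u u01) side_map_eucl mulrA.
(* Each covering set accounts for an interval of length 2 [C] times its diameter to the power s, and
   these intervals cover [0, 1]. *)
apply: (@lt_le_trans _ _ ((2 * C)^-1)%:E).
  by rewrite lte_fin invr_gt0 mulr_gt0.
apply: le_hausdorff => U bU dU.
pose V i := [set t : R | 0 <= t <= 1 /\ U i (y t)].
pose L i : R := C * fine (diam_powR (@snow_d R) (snow_dim R) (U i)).
have interval i : exists a : R, V i `<=` `[a - L i, a + L i]%classic.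
  have [[a [a01 Ua]]|] := pselect (V i !=set0); last first.
    by move=> /set0P/negP/negPn/eqP ->; exists 0.
  exists a => t [t01 Ut] /=; rewrite in_itv /= -ler_distl.
  apply: (le_trans (y_holder _ _ t01 a01)); rewrite /L ler_pM2l//.
  by have := diam_dimpow Ut Ua (dU i); rewrite lee_fin.
have [a aP] := choice interval.
have L0 i : 0 <= L i by rewrite mulr_ge0 ?powR_ge0// ltW.
have cover : (`[0, 1]%classic : set R) `<=` \bigcup_i `[a i - L i, a i + L i]%classic.
  move=> t; rewrite /= in_itv /= => t01.
  by have [i _ Ui] := bU _ (y_ball t t01); exists i => //; apply: aP.
have : (1%:E <= \sum_(i <oo) (2 * L i)%:E)%E.
  have : (lebesgue_measure (`[0%R, 1%R]%classic : set R) <=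
      \sum_(i <oo) lebesgue_measure (`[(a i - L i)%R, (a i + L i)%R]%classic : set R))%E.
    by apply: measure_sigma_subadditive => // i; exact: measurable_itv.
  rewrite lebesgue_measure_itv/= lte_fin ltr01 sube0 => /le_trans; apply.
  apply: lee_nneseries => // i _; rewrite lebesgue_measure_itv/= lte_fin.
  case: ifP => _; last by rewrite lee_fin mulr_ge0.
  by rewrite -EFinB lee_fin le_eqVlt; apply/orP; left; apply/eqP; ring.
under eq_eseriesr do rewrite /L mulrA EFinM.
rewrite nneseriesZl//; last by move=> i _; exact: diam_powR_ge0.
by rewrite -lee_pdivrMl ?mulr_gt0// mule1.
Qed.

(** The cells of depth n are numbered by their words in base 4, with the last digit of the number
    for the outermost map. *)
Lemma koch_cover n : exists U : nat -> set (R * R),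
  (forall i p q, U i p -> U i q -> eucl p q <= 2 * 3^-1 ^+ n) /\
  forall p, koch_curve p -> exists2 i, (i < 4 ^ n)%N & U i p.
Proof.
elim: n => [|n [U [dU KU]]].
  exists (fun=> @koch_curve R); split=> [i p q Kp Kq|p Kp]; last by exists 0%N.
  by rewrite expr0 mulr1; apply: koch_triangle_eucl; exact: koch_curve_triangle.
exists (fun i => [set koch_map (i %% 4) p | p in U (i %/ 4)%N]); split.
  move=> i _ _ [p Up <-] [q Uq <-]; rewrite koch_map_eucl exprS mulrCA ler_pM2l//.
  exact: dU Up Uq.
move=> p /koch_curve_split[i [q [i4 Kq pE]]].
have [k kn Uq] := KU q Kq; exists (k * 4 + i)%N.
  by rewrite expnS; lia.
exists q; first by rewrite divnMDl// divn_small// addn0.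
by rewrite modnMDl modn_small.
Qed.

(** The 3 * 4^n cells of diameter at most 2 * 3^-n contribute at most 3 * 2^s in total,
    independently of n. *)
Lemma snow_mu_lty (A : set (snowT R)) : (@snow_mu R A < +oo)%E.
Proof.
apply: (@le_lt_trans _ _ (3 * dimpow 2)%:E); last exact: ltry.
rewrite /snow_mu hausdorffE; apply: ge_ereal_sup => _ [delta [delta0 ->]].
have [n n_delta] := @geometric_lt 2 3^-1 delta ltac:(by rewrite invr_ge0) inv3_lt1 delta0.
have [U [dU KU]] := koch_cover n.
pose N := (3 * 4 ^ n)%N.
(* The residue modulo 3 selects the side and the quotient the Koch cell; the cover is padded with
   empty sets. *)
pose V i := if (i < N)%N
  then [set x : snowT R | exists2 p, U (i %/ 3)%N p & sval x = side_map (i %% 3) p]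
  else set0.
have dV i : (diam (@snow_d R) (V i) <= (2 * 3^-1 ^+ n)%:E)%E.
  apply: ge_ereal_sup => _ [x + [y + <-]]; rewrite /V; case: ifP => // _.
  move=> [p Up xE] [q Uq yE]; rewrite lee_fin /snow_d xE yE side_map_eucl.
  exact: dU Up Uq.
have s0 : snow_dim R != 0 by rewrite gt_eqF// snow_dim_gt0.
have dVpow i : (diam_powR (@snow_d R) (snow_dim R) (V i) <= (dimpow 2 / 4 ^+ n)%:E)%E.
  have e : dimpow (2 * 3^-1 ^+ n) = dimpow (2 : R) / 4 ^+ n.
    have h : 0 <= 2 * 3^-1 ^+ n :> R by rewrite mulr_ge0// exprn_ge0// invr_ge0.
    have := dimpow_exp3 n h; rewrite mulrCA -exprMn divff ?pnatr_eq0// expr1n mulr1.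
    by move=> ->; rewrite mulrAC divff ?mul1r// expf_neq0// pnatr_eq0.
  have [[x Vx]|] := pselect (V i !=set0); last first.
    by move=> /set0P/negP/negPn/eqP ->; rewrite diam_powR_set0.
  have d0 : (0 <= diam (@snow_d R) (V i))%E.
    by apply: le_trans (diam_ge _ Vx Vx); rewrite lee_fin eucl_ge0.
  rewrite lee_fin -e; apply: le_dimpow; first exact: fine_ge0.
  by rewrite -lee_fin fineK// ge0_fin_numE// (le_lt_trans (dV i)) ?ltry.
apply: (@le_trans _ _ (\sum_(i <oo) diam_powR (@snow_d R) (snow_dim R) (V i))%E).
  apply: ereal_inf_lbound; exists V; split=> // [x _|i]; last first.
    by apply: le_trans (dV i) _; rewrite lee_fin ltW.
  have [j [z [j3 Kz xE]]] := (snowflakeP (sval x)).1 (svalP x).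
  have [k kn Uk] := KU z Kz; exists (k * 3 + j)%N => //.
  have kN : (k * 3 + j < N)%N by rewrite /N; lia.
  rewrite /V kN /=; exists z; first by rewrite divnMDl// divn_small// addn0.
  by rewrite modnMDl modn_small.
apply: (@le_trans _ _ (N%:R * (dimpow 2 / 4 ^+ n))%:E).
  apply: nneseries_finite_le => [i|i _|i Ni]; [exact: diam_powR_ge0|exact: dVpow|].
  by rewrite /V ltnNge Ni/= diam_powR_set0.
rewrite lee_fin /N natrM natrX le_eqVlt; apply/orP; left; apply/eqP.
by field; rewrite expf_neq0// pnatr_eq0.
Qed.

Lemma snow_mm_space : mm_space (@snow_d R) (@snow_M R) (@snow_mu R).
Proof.
have s0 : snow_dim R != 0 by rewrite gt_eqF// snow_dim_gt0.
rewrite (_ : @snow_M R = (@snow_mu R).-caratheodory).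
  apply: hausdorff_mm_space => //; first exact: snow_d_is_metric.
  by move=> x r r0; apply/andP; split; [exact: snow_ball_gt0|exact: snow_mu_lty].
by apply/funext => A; apply/propext; split=> H E; rewrite [LHS]H setDE.
Qed.

(** The family of curves is empty, so the zero function is a witness; writing it as the indicator of
    the empty set gives its measurability and integrability class. *)
Lemma snow_zero_modulus :
  zero_Linf_modulus (@snow_d R) (@snow_M R) (@snow_mu R) (arc_curve (@snow_d R)).
Proof.
have [[_ Msa BM] [mu0 mu_ge0 _ _ _]] := snow_mm_space.
have zero : (fun=> 0%E) = chi set0 :> (snowT R -> \bar R).
  by apply/funext => x; rewrite /chi indic0.
exists (fun=> 0%E); split=> //.
- rewrite zero; apply: meas_fun_chi; first exact: smallest_sigma_algebra.
  by have [] := @smallest_sigma_algebra _ setT [set G | dopen (@snow_d R) G].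
- by rewrite zero; apply: (in_Linf_chi snow_mm_space); case: Msa.
- by move=> gam l /snow_no_arc_curve.
Qed.

Lemma snow_set1_null (x : snowT R) : outer (@snow_M R) (@snow_mu R) [set x] = 0%E.
Proof.
have s0 : snow_dim R != 0 by rewrite gt_eqF// snow_dim_gt0.
have [_ dE _ _] := @snow_d_is_metric R.
have x0 : @snow_mu R [set x] = 0%E by apply: hausdorff_set1 => //; exact/dE.
apply/eqP; rewrite eq_le; apply/andP; split; last first.
  by apply: le_ereal_inf_tmp => _ [A _ <-]; exact: hausdorff_ge0.
rewrite -[leRHS]x0; apply: ereal_inf_lbound; exists [set x] => //; split=> //.
exact/(dclosed_M snow_mm_space)/(set1_dclosed snow_mm_space).
Qed.

End snowflake_measure.

Theorem theorem1p1 (R : realType) :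
  (forall (T : Type) (d : T -> T -> R) (M : set (set T)) (mu : set T -> \bar R),
     mm_space d M mu ->
     (* L^oo-almost no nonconstant rectifiable curve *)
     zero_Linf_modulus d M mu (arc_curve d) ->
     forall x0 : T, outer M mu [set x0] = 0%E ->
     thm_conclusions d M mu x0)
  /\
  (* the von Koch snowflake with the (log 4/log 3)-Hausdorff measure *)
  (forall x0 : snowT R,
     thm_conclusions (@snow_d R) (@snow_M R) (@snow_mu R) x0).
Proof.
split=> [T d M mu mm mod0 x0 x0_null|x0]; first exact: negligible_curves_conclusions.
apply: negligible_curves_conclusions; first exact: snow_mm_space.
  exact: snow_zero_modulus.
exact: snow_set1_null.
Qed.
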